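(* Let $d\in\{1,2,3\}$, let $p\in(2,\infty)\cap\mathbb{Q}$ and let $k_p,\ell_p\in\mathbb{N}$ be such that $p=2+2\ell_p/k_p$. Let $K\subset\mathbb{R}^d$ be a $d$-dimensional simplex, let $F\subset\partial K$ be one of its faces, and let $r\in\mathbb{N}$. Then, for all polynomials $w,v\in\mathcal{P}_r(K)$, $$\int_F\left(|\nabla w|+|\nabla v|\right)^{p-2}|\nabla v|^2\,\mathrm{d}s\leq 2^{p/2+1/k_p}C_{\mathrm{inv},d}\frac{(2p^2k_p^2(r-1)^2+1)|F|}{d|K|}\int_K\left(|\nabla w|+|\nabla v|\right)^{p-2}|\nabla v|^2\,\mathrm{d}\mathbf{x},$$ where $C_{\mathrm{inv},d}=1,4,8$ for $d=1,2,3$, respectively.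
   Context: $\mathcal{P}_r(K)$ denotes the real polynomials of total degree at most $r$ on $K$; $|K|$ is the $d$-dimensional Lebesgue measure and $|F|$ the $(d-1)$-dimensional measure (for $d=1$ a face is an endpoint, integration over it is point evaluation, and $|F|=1$). $\mathbb{N}=\{1,2,\dots\}$, and $|\cdot|$ of a vector is the Euclidean norm. *)

(* Defs.v *)
From HB Require Import structures.
From mathcomp Require Import all_boot all_order all_algebra.
(* mpoly clashes with MathComp-Analysis on notations, and on some names (such as
   isMeasure), for which the latter must come last. *)
From mathcomp Require Import -(notations) mpoly.
From mathcomp Require Import all_classical all_reals all_analysis.
From mathcomp Require Import measurable_realfun.

Set Implicit Arguments.
Unset Strict Implicit.
Unset Printing Implicit Defensive.
Import Order.TTheory GRing.Theory Num.Theory.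
Import numFieldNormedType.Exports.
Local Open Scope classical_set_scope.
Local Open Scope ring_scope.

(* Tuples, unlike row vectors, are a measurable space in MathComp-Analysis: they
   carry the product of the Borel sigma-algebras of the coordinates. *)
Notation euclid R n := (n.-tuple (measurableTypeR R)).

Definition econs (R : realType) (n : nat)
  (x : measurableTypeR R * euclid R n) : euclid R n.+1 := [tuple of x.1 :: x.2].

(* lebesgueN 0 is the unit mass at the only point of R^0. *)
Fixpoint lebesgueN (R : realType) (n : nat) : set (euclid R n) -> \bar R :=
  match n with
  | 0 => dirac ([tuple] : euclid R 0)
  | m.+1 => pushforward (lebesgue_measure \x @lebesgueN R m)%E (@econs R m)
  end.
Arguments lebesgueN : clear implicits.

Section lebesgueN_measure.
Local Open Scope ereal_scope.
Context (R : realType).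

Lemma measurable_econs n : measurable_fun [set: _] (@econs R n).
Proof. exact: measurable_cons measurable_fst measurable_snd. Qed.

Section step.
Context (n : nat) (mu : {sigma_finite_measure set (euclid R n) -> \bar R}).

Definition lebesgueS_fun : set (euclid R n.+1) -> \bar R :=
  pushforward (lebesgue_measure \x mu) (@econs R n).

Let nu0 : lebesgueS_fun set0 = 0.
Proof. by rewrite /lebesgueS_fun /pushforward preimage_set0 measure0. Qed.

Let nu_ge0 A : 0 <= lebesgueS_fun A.
Proof. by apply: integral_ge0 => *; exact: measure_ge0. Qed.

Let nu_sigma_additive : semi_sigma_additive lebesgueS_fun.
Proof.
have mf := @measurable_econs n.
exact: measure_semi_sigma_additive.
Qed.

HB.instance Definition _ :=
  isMeasure.Build _ _ _ lebesgueS_fun nu0 nu_ge0 nu_sigma_additive.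

Let nu_sigma_finite : sigma_finite setT lebesgueS_fun.
Proof.
have /sigma_finiteP[F [TF ndF Foo]] := sigma_finiteT (@lebesgue_measure R).
have /sigma_finiteP[G [TG ndG Goo]] := sigma_finiteT mu.
pose bh (t : euclid R n.+1) : euclid R n := [tuple of behead t].
exists (fun k => (@tnth _ _ ^~ ord0) @^-1` F k `&` bh @^-1` G k).
  apply/esym; rewrite -subTset => t _.
  have [i _ Fi] : (\bigcup_i F i) (tnth t ord0) by rewrite -TF.
  have [j _ Gj] : (\bigcup_i G i) (bh t) by rewrite -TG.
  exists (maxn i j) => //; split.
  - exact: (subsetPset _ _ (ndF _ _ (leq_maxl i j)) _ Fi).
  - exact: (subsetPset _ _ (ndG _ _ (leq_maxr i j)) _ Gj).
move=> k; have [mF Fk] := Foo k; have [mG Gk] := Goo k; split.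
  apply: measurableI.
    by rewrite -[X in measurable X]setTI; exact: measurable_tnth.
  by rewrite -[X in measurable X]setTI; exact: measurable_behead.
rewrite /lebesgueS_fun /pushforward [X in (_ \x _) X](_ : _ = F k `*` G k).
  by rewrite product_measure1E// lte_mul_pinfty// ge0_fin_numE.
have bhE x : bh (econs x) = x.2 by exact: val_inj.
by apply/seteqP; split=> x /=; rewrite bhE.
Qed.

HB.instance Definition _ :=
  Measure_isSigmaFinite.Build _ _ _ lebesgueS_fun nu_sigma_finite.

Definition lebesgueS : {sigma_finite_measure set (euclid R n.+1) -> \bar R} :=
  lebesgueS_fun.

End step.

Lemma lebesgueN_sigma_finite_measure n :
  exists mu : {sigma_finite_measure set (euclid R n) -> \bar R},
    lebesgueN R n = mu.
Proof.
elim: n => [|n [mu /= ->]]; last by exists (lebesgueS mu).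
by exists (dirac ([tuple] : euclid R 0)).
Qed.

Context (n : nat).

Let lebesgueN0 : lebesgueN R n set0 = 0.
Proof. by have [mu ->] := lebesgueN_sigma_finite_measure n. Qed.

Let lebesgueN_ge0 A : 0 <= lebesgueN R n A.
Proof. by have [mu ->] := lebesgueN_sigma_finite_measure n. Qed.

Let lebesgueN_sigma_additive : semi_sigma_additive (lebesgueN R n).
Proof.
have [mu ->] := lebesgueN_sigma_finite_measure n.
exact: measure_semi_sigma_additive.
Qed.

HB.instance Definition _ := isMeasure.Build _ _ _ (lebesgueN R n)
  lebesgueN0 lebesgueN_ge0 lebesgueN_sigma_additive.

Let lebesgueN_sigma_finite : sigma_finite setT (lebesgueN R n).
Proof.
have [mu ->] := lebesgueN_sigma_finite_measure n; exact: sigma_finiteT.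
Qed.

HB.instance Definition _ := Measure_isSigmaFinite.Build _ _ _ (lebesgueN R n)
  lebesgueN_sigma_finite.

End lebesgueN_measure.

Section simplex.
Context (R : realType) (m d : nat).
Implicit Type b : 'I_m.+1 -> euclid R d.

Definition edges b : 'M[R]_(m, d) :=
  \matrix_(i, j) (tnth (b (lift ord0 i)) j - tnth (b ord0) j).

Definition affinely_independent b := row_free (edges b).

(* The convex hull of the points b. *)
Definition simplex b : set (euclid R d) :=
  [set x | exists2 c : 'I_m.+1 -> R,
     (forall i, 0 <= c i) /\ \sum_i c i = 1 &
     forall j, tnth x j = \sum_i c i * tnth (b i) j].

Definition flat_param b (t : euclid R m) : euclid R d :=
  [tuple tnth (b ord0) j + \sum_i tnth t i * edges b i j | j < d].

(* The m-dimensional measure carried by the affine hull of m + 1 affinely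
   independent points of R^d: Lebesgue measure on R^m transported by an affine
   parametrization, times the Jacobian sqrt (det (E E^T)) of the latter, which
   makes the result independent of the choice of the points in the affine hull.
   For m = 0 it is the unit mass at the point b ord0. *)
Definition flat_measure b (A : set (euclid R d)) : \bar R :=
  ((Num.sqrt (\det (edges b *m (edges b)^T)))%:E *
   pushforward (lebesgueN R m) (flat_param b) A)%E.

Lemma measurable_flat_param b : measurable_fun [set: _] (flat_param b).
Proof.
apply/measurable_fun_tnthP => j.
rewrite (_ : _ \o _ = fun t : euclid R m =>
  tnth (b ord0) j + \sum_i tnth t i * edges b i j : R); last first.
  by apply/funext => t /=; rewrite tnth_mktuple.
apply: measurable_funD; first exact: measurable_cst.
apply: measurable_sum => i; apply: measurable_funM; last exact: measurable_cst.
exact: measurable_tnth.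
Qed.

Section flat_measure_measure.
Context b.

Let nu : {measure set (euclid R m) -> \bar R} :=
  mscale (NngNum (sqrtr_ge0 (\det (edges b *m (edges b)^T)))) (lebesgueN R m).

Let mf := @measurable_flat_param b.

Let flat_measure0 : flat_measure b set0 = 0%E.
Proof. exact: (measure0 nu). Qed.

Let flat_measure_ge0 A : (0 <= flat_measure b A)%E.
Proof. exact: (measure_ge0 nu). Qed.

Let flat_measure_sigma_additive : semi_sigma_additive (flat_measure b).
Proof.
rewrite (_ : flat_measure b = pushforward nu (flat_param b))//.
exact: measure_semi_sigma_additive.
Qed.

HB.instance Definition _ := isMeasure.Build _ _ _ (flat_measure b)
  flat_measure0 flat_measure_ge0 flat_measure_sigma_additive.

End flat_measure_measure.

End simplex.

(* The face of the simplex with vertices a that is opposite to the vertex a i. *)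
Definition face_vertices (R : realType) (m d : nat)
  (a : 'I_m.+2 -> euclid R d) (i : 'I_m.+2) : 'I_m.+1 -> euclid R d :=
  a \o lift i.

(* The Euclidean norm of the gradient of a polynomial. *)
Definition grad_norm (R : realType) (d : nat) (w : mpoly d R)
  (x : euclid R d) : R :=
  Num.sqrt (\sum_i (meval (tnth x) (mderiv i w)) ^+ 2).

Definition C_inv (R : realType) (d : nat) : R := nth 0 [:: 0; 1; 4; 8] d.

(* Main.v *)
Require Import Defs.
From HB Require Import structures.
From mathcomp Require Import all_boot all_order all_algebra.
From mathcomp Require Import -(notations) mpoly.
From mathcomp Require Import all_classical all_reals all_analysis.
From mathcomp Require Import measurable_realfun ring lra.
Set Implicit Arguments.
Unset Strict Implicit.
Unset Printing Implicit Defensive.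
Import Order.TTheory GRing.Theory Num.Theory.
Import numFieldNormedType.Exports.
Local Open Scope classical_set_scope.
Local Open Scope ring_scope.

(* Up to the factor 2^(p/2 - 1), the integrand is G^(1/k) where
   G = (|Dw|^2 + |Dv|^2)^l |Dv|^(2k) has degree at most N = p k (r - 1) on every
   line.  In polar form around the vertex A opposite to F, the integral over K is
   a constant times that of t^(d-1) G(A + t (y - A))^(1/k) over t in [0, 1] and
   y in F, and taking the constant integrand 1 shows that the constant is
   d |K| / |F|.  It remains to bound the value at t = 1 of the power s <= 1 of a
   nonnegative polynomial P of degree N on [c, 1], where c = 0 if d = 1 and
   c = 1/2 otherwise.  The estimate P(0)^2 <= (N + 1)^2 int_0^1 P^2, applied on
   both sides of a maximum point of P, gives
   (1 - c) M^2 <= (N + 1)^2 int_c^1 P^2 <= (N + 1)^2 M^(2 - s) int_c^1 P^s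
   for the maximum M of P.  The numbers 1, 4, 8 are 1 / ((1 - c) c^(d-1)). *)

(** The rationality of p is what brings in polynomials: |Dw|^2 and |Dv|^2 are polynomials on a line,
    although the norms are not, and the exponent l/k becomes an integer after raising to the power
    k. Trading (|Dw| + |Dv|)^2 for |Dw|^2 + |Dv|^2 is what costs the factor 2^(p/2 - 1). The cut at
    c is forced by the weight t^(d-1), which vanishes at the vertex A when d > 1. (N + 1)^2 is the
    squared norm of the functional p -> p(0) on polynomials of degree at most N in L^2(0, 1).
    Neither the Jacobian of the polar form nor the volume of the reference simplex is computed. Both
    are only shown to be positive and finite, the former through the uniqueness of the Haar measure,
    and the ratio |F| / (d |K|) absorbs them. The bound obtained is below the stated one: (N + 1)^2
    <= 2 (2 N^2 + 1), and 2 * 2^(p/2 - 1) = 2^(p/2) <= 2^(p/2 + 1/k). *)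

Lemma measurable_tuple_of (R : realType) d (T : measurableType d) n
    (F : T -> 'I_n -> R) :
  (forall j, measurable_fun [set: T] (F ^~ j)) ->
  measurable_fun [set: T] (fun x => [tuple F x j | j < n] : euclid R n).
Proof.
move=> mF; apply/measurable_fun_tnthP => j.
rewrite (_ : _ \o _ = F ^~ j); first exact: mF.
by apply/funext => x /=; rewrite tnth_mktuple.
Qed.

(** * Translation invariance of the Lebesgue measure on R^n *)

Section translation.
Context (R : realType).
Local Open Scope ereal_scope.
Implicit Type n : nat.

Lemma lebesgue_measure_translate (c : R) (A : set R) : measurable A ->
  pushforward (@lebesgue_measure R)
    ((fun x => x + c)%R : _ -> measurableTypeR R) A = lebesgue_measure A.
Proof.
move=> mA; have mf : measurable_fun [set: measurableTypeR R]
  ((fun x => x + c)%R : _ -> measurableTypeR R) by exact: measurable_funD.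
apply/esym/lebesgue_measure_unique => //= _ [[a b]] _ <-.
rewrite /pushforward.
rewrite (_ : _ @^-1` _ = `](a - c)%R, (b - c)%R]%classic).
  rewrite !lebesgue_measure_itv/= !lte_fin ltrD2r.
  by case: ifP => // _; rewrite -!EFinB; congr (_%:E); ring.
by apply/seteqP; split=> x; rewrite /= !in_itv/= ltrBlDr lerBrDr.
Qed.

Lemma integral_translate (c : R) (f : R -> \bar R) :
  measurable_fun [set: R] f -> (forall x, 0 <= f x) ->
  \int[lebesgue_measure]_x f (x + c)%R = \int[lebesgue_measure]_x f x.
Proof.
move=> mf f0.
have mg : measurable_fun [set: measurableTypeR R]
  ((fun x => x + c)%R : _ -> measurableTypeR R) by exact: measurable_funD.
rewrite -[LHS](@ge0_integral_pushforward _ _ _ _ _ _ mg lebesgue_measure setT)//.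
by apply: eq_measure_integral => A mA _; exact: lebesgue_measure_translate.
Qed.

Lemma integral_lebesgueN0 (f : euclid R 0 -> \bar R) :
  \int[lebesgueN R 0]_x f x = f [tuple].
Proof.
rewrite (_ : f = cst (f [tuple])); last by apply/funext => x; rewrite (tuple0 x).
by rewrite integral_cst//= diracT mule1.
Qed.

Lemma integral_lebesgueNS n (f : euclid R n.+1 -> \bar R) :
  measurable_fun [set: euclid R n.+1] f -> (forall x, 0 <= f x) ->
  \int[lebesgueN R n.+1]_x f x =
  \int[lebesgue_measure]_t \int[lebesgueN R n]_y f (econs (t, y)).
Proof.
move=> mf f0; have mE := @measurable_econs R n.
rewrite [LHS](_ : _ = \int[pushforward (lebesgue_measure \x lebesgueN R n)%E
  (@econs R n)]_x f x)//.
rewrite ge0_integral_pushforward//= fubini_tonelli1//.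
exact: measurableT_comp.
Qed.

Definition tadd n (x y : euclid R n) : euclid R n :=
  [tuple (tnth x j + tnth y j)%R | j < n].

Lemma measurable_tadd n d (T : measurableType d) (f g : T -> euclid R n) :
  measurable_fun [set: T] f -> measurable_fun [set: T] g ->
  measurable_fun [set: T] (fun x => tadd (f x) (g x)).
Proof.
move=> /measurable_fun_tnthP mf /measurable_fun_tnthP mg.
apply: (@measurable_tuple_of R _ T n
  (fun x j => tnth (f x) j + tnth (g x) j)%R) => j.
by apply: measurable_funD; [exact: mf|exact: mg].
Qed.

Lemma tadd_econs n (t s : R) (x y : euclid R n) :
  tadd (econs (t, x)) (econs (s, y)) = econs ((t + s)%R, tadd x y).
Proof.
apply: eq_from_tnth => j; rewrite tnth_mktuple.
have [k ->|->] := unliftP ord0 j; last by rewrite !tnth0.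
by rewrite !tnthS tnth_mktuple.
Qed.

Lemma econs_tupleE n (x : euclid R n.+1) :
  x = econs (thead x, [tuple of behead x]).
Proof. exact: tuple_eta. Qed.

(** Tonelli peels off the first coordinate: the inner integral is translated by the induction
    hypothesis, the outer one by the one-dimensional case. *)
Lemma integral_tadd n (c : euclid R n) (f : euclid R n -> \bar R) :
  measurable_fun [set: euclid R n] f -> (forall x, 0 <= f x) ->
  \int[lebesgueN R n]_x f (tadd x c) = \int[lebesgueN R n]_x f x.
Proof.
elim: n c f => [|n ih] c f mf f0.
  by rewrite !integral_lebesgueN0; congr f; apply: eq_from_tnth; case.
transitivity (\int[lebesgue_measure]_t \int[lebesgueN R n]_y f (tadd (econs (t, y)) c)).
  apply: (integral_lebesgueNS (f := fun x => f (tadd x c))).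
  - by apply: (measurableT_comp mf); exact: measurable_tadd.
  - by move=> x; exact: f0.
apply/esym; transitivity (\int[lebesgue_measure]_t
    \int[lebesgueN R n]_y f (econs (t, y))).
  exact: integral_lebesgueNS.
apply/esym; rewrite (econs_tupleE c).
set s := thead c; set y := [tuple of behead c].
transitivity (\int[lebesgue_measure]_t
    \int[lebesgueN R n]_x f (econs ((t + s)%R, x))).
  apply: eq_integral => t _.
  under eq_integral do rewrite tadd_econs.
  apply: (ih y (fun x => f (econs ((t + s)%R, x)))) => //.
  apply: (measurableT_comp mf).
  by apply: (measurableT_comp (@measurable_econs R n)).
apply: (@integral_translate s (fun t =>
  \int[lebesgueN R n]_x f (econs (t, x)))) => [|t].
  apply: (measurable_fun_fubini_tonelli_F (f \o @econs R n)) => [|x].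
    by apply: measurableT_comp => //; exact: measurable_econs.
  exact: f0.
by rewrite /=; apply: integral_ge0 => x _; exact: f0.
Qed.

End translation.

Lemma measurable_forall_fin d (T : measurableType d) (I : finType)
    (P : I -> T -> Prop) :
  (forall i, measurable [set x | P i x]) -> measurable [set x | forall i, P i x].
Proof.
move=> mP; rewrite (_ : mkset _ = \big[setI/setT]_(i : I) [set x | P i x]).
  exact: bigsetI_measurable.
rewrite -bigcap_seq; apply/seteqP; split=> [x Px i _ //|x Px i].
by apply: Px => /=; rewrite mem_index_enum.
Qed.

Lemma measurable_set_le d (T : measurableType d) (R : realType) (f g : T -> R) :
  measurable_fun [set: T] f -> measurable_fun [set: T] g ->
  measurable [set x | f x <= g x].
Proof.
move=> mf mg; rewrite -[X in measurable X]setTI.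
exact: measurable_fun_le.
Qed.

(** * Linear maps and the uniqueness of the Haar measure *)

Section linear_maps.
Context (R : realType).

Definition mxmap m n (A : 'M[R]_(m, n)) (x : euclid R m) : euclid R n :=
  [tuple \sum_i tnth x i * A i j | j < n].

Lemma measurable_mxmap m n (A : 'M[R]_(m, n)) :
  measurable_fun [set: euclid R m] (mxmap A).
Proof.
apply: (@measurable_tuple_of R _ (euclid R m) n
  (fun x j => \sum_i tnth x i * A i j)%R) => j.
apply: measurable_sum => i; apply: measurable_funM; last exact: measurable_cst.
exact: measurable_tnth.
Qed.

Lemma mxmap_comp m n k (A : 'M[R]_(m, n)) (B : 'M[R]_(n, k)) x :
  mxmap B (mxmap A x) = mxmap (A *m B) x.
Proof.
apply: eq_from_tnth => j; rewrite !tnth_mktuple.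
under eq_bigr do rewrite tnth_mktuple mulr_suml.
rewrite exchange_big /=; apply: eq_bigr => i _; rewrite mxE mulr_sumr.
by apply: eq_bigr => l _; rewrite mulrA.
Qed.

Lemma mxmap1 n (x : euclid R n) : mxmap 1%:M x = x.
Proof.
apply: eq_from_tnth => j; rewrite tnth_mktuple (bigD1 j)//= mxE eqxx mulr1.
rewrite big1 ?addr0// => i ij.
by rewrite mxE (negbTE ij) mulr0.
Qed.

Lemma mxmapD m n (A : 'M[R]_(m, n)) x y :
  mxmap A (tadd x y) = tadd (mxmap A x) (mxmap A y).
Proof.
apply: eq_from_tnth => j; rewrite !tnth_mktuple -big_split /=.
by apply: eq_bigr => i _; rewrite tnth_mktuple mulrDl.
Qed.

(** The ball of the sup norm: a reference set of known measure, against which the effect of a linear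
    map on volumes is gauged. *)
Definition cube n (r : R) : set (euclid R n) :=
  [set x | forall i, `|tnth x i| <= r].

Lemma measurable_cube n r : measurable (@cube n r).
Proof.
apply: measurable_forall_fin => i; apply: measurable_set_le => //.
by apply: measurableT_comp; [exact: normr_measurable | exact: measurable_tnth].
Qed.

Lemma lebesgueN_cube n (r : R) : 0 <= r ->
  lebesgueN R n (@cube n r) = ((2 * r) ^+ n)%:E.
Proof.
move=> r0; elim: n => [|n ih].
  by rewrite expr0 /= diracE mem_set// => -[].
rewrite /= /pushforward (_ : _ @^-1` _ = `[- r, r]%classic `*` @cube n r).
  rewrite product_measure1E//=; last exact: measurable_cube.
  rewrite ih lebesgue_measure_itv/= lte_fin exprS EFinM.
  case: ltP => [_|r_le]; first by rewrite -EFinB; congr (_%:E * _)%E; ring.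
  by rewrite (_ : r = 0) ?mulr0//; lra.
apply/seteqP; split=> [[t y] /= ty|[t y] /= [ty yr] i].
  split; first by have := ty ord0; rewrite tnth0/= in_itv/= ler_norml.
  by move=> i; have := ty (lift ord0 i); rewrite tnthS.
have [j ->|->] := unliftP ord0 i; first by rewrite tnthS.
by move: ty; rewrite tnth0 in_itv/= ler_norml.
Qed.

Lemma cube_mxmap m n (A : 'M[R]_(m, n)) r x : cube r x ->
  cube (r * \sum_i \sum_j `|A i j|) (mxmap A x).
Proof.
move=> rx j; rewrite tnth_mktuple.
apply: le_trans (ler_norm_sum _ _ _) _.
rewrite mulr_sumr; apply: ler_sum => i _.
rewrite normrM ler_pM// (bigD1 j)//= lerDl.
by apply: sumr_ge0.
Qed.


Lemma taddC n : commutative (@tadd R n).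
Proof.
by move=> x y; apply: eq_from_tnth => j; rewrite !tnth_mktuple addrC.
Qed.

(* Uniqueness of the Haar measure, for the image of the Lebesgue measure by A:
   both sides are the integral of (x, y) |-> f (A x + y) * g (- A x). *)
Lemma integral_mxmapM n (A : 'M[R]_n) (f g : euclid R n -> \bar R) :
  A \in unitmx ->
  measurable_fun [set: _] f -> (forall x, 0 <= f x)%E ->
  measurable_fun [set: _] g -> (forall x, 0 <= g x)%E ->
  ((\int[lebesgueN R n]_x f (mxmap A x)) * \int[lebesgueN R n]_x g x =
   (\int[lebesgueN R n]_x f x) * \int[lebesgueN R n]_x g (mxmap (- A) x))%E.
Proof.
move=> uA mf f0 mg g0.
have mA := @measurable_mxmap n n A; have mNA := @measurable_mxmap n n (- A).
have mfA := measurableT_comp mf mA; have mgA := measurableT_comp mg mNA.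
have mfD : measurable_fun [set: euclid R n * euclid R n]
    (fun z => f (tadd (mxmap A z.1) z.2)).
  apply: (measurableT_comp mf); apply: measurable_tadd => //.
  exact: measurableT_comp.
have mgD : measurable_fun [set: euclid R n * euclid R n]
    (fun z => g (tadd z.2 (mxmap (- A) z.1))).
  apply: (measurableT_comp mg); apply: measurable_tadd => //.
  exact: measurableT_comp.
have intZl k h : measurable_fun [set: euclid R n] h -> (forall x, 0 <= h x)%E ->
    (0 <= k)%E -> (\int[lebesgueN R n]_x (k * h x) =
                   k * \int[lebesgueN R n]_x h x)%E.
  by move=> mh h0 k0; exact: ge0_integralZl.
have intZr k h : measurable_fun [set: euclid R n] h -> (forall x, 0 <= h x)%E ->
    (0 <= k)%E -> (\int[lebesgueN R n]_x (h x * k) =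
                   (\int[lebesgueN R n]_x h x) * k)%E.
  by move=> mh h0 k0; exact: ge0_integralZr.
have int0 h : (forall x, 0 <= h x)%E -> (0 <= \int[lebesgueN R n]_x h x)%E.
  by move=> h0; exact: integral_ge0.
transitivity (\int[lebesgueN R n]_x \int[lebesgueN R n]_y
    (f (mxmap A x) * g (tadd y (mxmap (- A) x))))%E.
  rewrite -(intZr _ (fun x => f (mxmap A x)))//; last exact: int0.
  apply: eq_integral => x _; rewrite intZl//.
    by congr (_ * _)%E; apply/esym/integral_tadd.
  by apply: (measurableT_comp mg); apply: measurable_tadd.
transitivity (\int[lebesgueN R n]_y \int[lebesgueN R n]_x
    (f (mxmap A x) * g (tadd y (mxmap (- A) x))))%E.
  apply: (fubini_tonelli (fun z : euclid R n * euclid R n =>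
    f (mxmap A z.1) * g (tadd z.2 (mxmap (- A) z.1)))%E) => [|z].
  - apply: emeasurable_funM => //.
    by apply: (measurableT_comp mfA).
  - exact: mule_ge0.
transitivity (\int[lebesgueN R n]_y \int[lebesgueN R n]_x
    (f (tadd (mxmap A x) y) * g (mxmap (- A) x)))%E.
  apply: eq_integral => y _; apply/esym.
  (* Translating x by this preimage of y turns A x into A x + y and y - A x into - A x.
     Invertibility of A enters only here. *)
  pose c := mxmap (invmx A) y.
  have Ac : mxmap A c = y by rewrite mxmap_comp mulVmx// mxmap1.
  have NAc x : tadd y (mxmap (- A) (tadd x c)) = mxmap (- A) x.
    rewrite mxmapD; apply: eq_from_tnth => j; rewrite !tnth_mktuple.
    rewrite -[in RHS](addr0 (\sum_i _)) addrCA; congr (_ + _).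
    under [X in _ + X]eq_bigr do rewrite mxE mulrN.
    by rewrite sumrN -Ac tnth_mktuple subrr.
  rewrite -[RHS](@integral_tadd R n c).
  - by apply: eq_integral => x _; rewrite mxmapD Ac NAc.
  - apply: emeasurable_funM; first exact: mfA.
    by apply: (measurableT_comp mg); exact: measurable_tadd.
  - by move=> x; exact: mule_ge0.
transitivity (\int[lebesgueN R n]_x \int[lebesgueN R n]_y
    (f (tadd (mxmap A x) y) * g (mxmap (- A) x)))%E.
  apply/esym.
  apply: (fubini_tonelli (fun z : euclid R n * euclid R n =>
    f (tadd (mxmap A z.1) z.2) * g (mxmap (- A) z.1))%E) => [|z].
  - apply: emeasurable_funM => //.
    by apply: (measurableT_comp mgA).
  - exact: mule_ge0.
rewrite -(intZl _ (fun x => g (mxmap (- A) x)))//; last exact: int0.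
apply: eq_integral => x _; rewrite intZr//.
  congr (_ * _)%E; rewrite -[RHS](integral_tadd (mxmap A x) mf f0).
  by apply: eq_integral => y _; rewrite taddC.
by apply: (measurableT_comp mf); exact: measurable_tadd.
Qed.

End linear_maps.

(** * Linear changes of variables *)

Section change_of_variables.
Context (R : realType).

(** The case where g is the indicator of the unit cube, of measure 2^n. The factor relating the two
    integrals of f is then the same for all f. *)
Lemma integral_mxmap_cube n (A : 'M[R]_n) (f : euclid R n -> \bar R) :
  A \in unitmx -> measurable_fun [set: _] f -> (forall x, 0 <= f x)%E ->
  ((\int[lebesgueN R n]_x f (mxmap A x)) * (2 ^+ n)%:E =
   (\int[lebesgueN R n]_x f x) *
     lebesgueN R n (mxmap (- A) @^-1` @cube R n 1))%E.
Proof.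
move=> uA mf f0; have mC := @measurable_cube R n 1.
have mpC : measurable (mxmap (- A) @^-1` @cube R n 1).
  by rewrite -[X in measurable X]setTI; exact: measurable_mxmap.
rewrite -[in LHS](mulr1 2) -lebesgueN_cube// -(setIT (cube _)) -integral_indic//.
pose g (x : euclid R n) : \bar R := (\1_(@cube R n 1) x)%:E.
have mg : measurable_fun [set: _] g by apply/measurable_EFinP.
have g0 x : (0 <= g x)%E by rewrite lee_fin.
rewrite (integral_mxmapM uA mf f0 mg g0); congr (_ * _)%E.
transitivity (\int[lebesgueN R n]_x
    (\1_(mxmap (- A) @^-1` @cube R n 1) x)%:E)%E; first by [].
by rewrite integral_indic// setIT.
Qed.

(** The constant c is |det A|, left unidentified. It is positive and finite because the preimage [C]
    of the unit cube lies between two cubes, by the crude operator bounds [s] for - A and [s'] for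
    its inverse. *)
Lemma integral_mxmap n (A : 'M[R]_n) : A \in unitmx ->
  exists2 c : R, 0 < c & forall f : euclid R n -> \bar R,
    measurable_fun [set: _] f -> (forall x, 0 <= f x)%E ->
    (\int[lebesgueN R n]_x f x = c%:E * \int[lebesgueN R n]_x f (mxmap A x))%E.
Proof.
move=> uA; set C := mxmap (- A) @^-1` @cube R n 1.
have mC : measurable C.
  rewrite -[X in measurable X]setTI.
  by apply: measurable_mxmap => //; exact: measurable_cube.
pose s := \sum_i \sum_j `|(- A) i j|.
have s0 : 0 <= s by apply: sumr_ge0 => i _; apply: sumr_ge0.
pose s' := \sum_i \sum_j `|(- invmx A) i j|.
have s'0 : 0 <= s' by apply: sumr_ge0 => i _; apply: sumr_ge0.
(* The radius 1 / (1 + s) makes sense even for n = 0, where s = 0. *)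
have s1 : 0 < 1 + s by rewrite ltr_wpDr.
have Cge : (((2 * (1 + s)^-1) ^+ n)%:E <= lebesgueN R n C)%E.
  rewrite -lebesgueN_cube ?invr_ge0 ?(ltW s1)//; apply: le_measure; rewrite ?inE//.
    exact: measurable_cube.
  move=> x /(cube_mxmap (- A)) xC i; apply: le_trans (xC i) _.
  by rewrite mulrC ler_pdivrMr// mul1r lerDr.
have Cle : (lebesgueN R n C <= ((2 * s') ^+ n)%:E)%E.
  rewrite -lebesgueN_cube//; apply: le_measure; rewrite ?inE//.
    exact: measurable_cube.
  move=> x /(cube_mxmap (- invmx A)).
  by rewrite mul1r mxmap_comp mulmxN mulNmx opprK mulmxV// mxmap1.
pose v := fine (lebesgueN R n C).
have vE : (lebesgueN R n C = v%:E)%E.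
  rewrite fineK// ge0_fin_numE//; exact: le_lt_trans Cle (ltry _).
have v0 : 0 < v.
  by rewrite -lte_fin -vE (lt_le_trans _ Cge)// lte_fin exprn_gt0// mulr_gt0// invr_gt0.
have pow0 : 0 < 2 ^+ n :> R by rewrite exprn_gt0.
exists (2 ^+ n / v) => [|f mf f0]; first by rewrite divr_gt0.
have := integral_mxmap_cube uA mf f0; rewrite -/C vE => IE.
rewrite EFinM -muleA (muleC (v^-1)%:E) muleA (muleC (2 ^+ n)%:E) IE.
by rewrite -muleA -EFinM divff ?gt_eqF// mule1.
Qed.

Definition tscale n (t : R) (x : euclid R n) : euclid R n :=
  [tuple t * tnth x j | j < n].

Lemma measurable_tscale n d (T : measurableType d) (f : T -> R)
    (g : T -> euclid R n) :
  measurable_fun [set: T] f -> measurable_fun [set: T] g ->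
  measurable_fun [set: T] (fun x => tscale (f x) (g x)).
Proof.
move=> mf /measurable_fun_tnthP mg.
apply: (@measurable_tuple_of R _ T n (fun x j => f x * tnth (g x) j)) => j.
by apply: measurable_funM => //; exact: mg.
Qed.

Lemma mxmap_scalar n (t : R) (x : euclid R n) : mxmap t%:M x = tscale t x.
Proof.
apply: eq_from_tnth => j; rewrite !tnth_mktuple (bigD1 j)//= mxE eqxx mulr1n.
rewrite big1 ?addr0 1?mulrC// => i ij.
by rewrite mxE (negbTE ij) mulr0.
Qed.

(** For a homothety the constant can be read off: the preimage of the unit cube is the cube of
    radius 1/t. *)
Lemma integral_tscale n (t : R) (f : euclid R n -> \bar R) : 0 < t ->
  measurable_fun [set: _] f -> (forall x, 0 <= f x)%E ->
  (\int[lebesgueN R n]_x f x =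
   (t ^+ n)%:E * \int[lebesgueN R n]_x f (tscale t x))%E.
Proof.
move=> t0 mf f0.
have ut : (t%:M : 'M[R]_n) \in unitmx.
  by rewrite unitmxE det_scalar unitrX// unitfE gt_eqF.
have := integral_mxmap_cube ut mf f0.
rewrite (_ : _ @^-1` _ = @cube R n t^-1); last first.
  have cubeE (x : euclid R n) i :
      (`|tnth (mxmap (- t%:M) x) i| <= 1) = (`|tnth x i| <= t^-1).
    rewrite -raddfN /= mxmap_scalar tnth_mktuple normrM normrN (gtr0_norm t0).
    by rewrite -[t^-1]mul1r ler_pdivlMr// mulrC.
  by apply/seteqP; split=> x /= tx i; have := tx i; rewrite cubeE.
rewrite lebesgueN_cube ?invr_ge0 ?ltW// => IE.
under [in RHS]eq_integral do rewrite -mxmap_scalar.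
have pow0 : 0 < 2 ^+ n :> R by rewrite exprn_gt0.
have := congr1 (fun z => z * (t ^+ n / 2 ^+ n)%:E)%E IE.
have -> : ((\int[lebesgueN R n]_x f x) * ((2 * t^-1) ^+ n)%:E *
    (t ^+ n / 2 ^+ n)%:E = \int[lebesgueN R n]_x f x)%E.
  rewrite -muleA -EFinM exprMn exprVn mulrA mulfVK ?gt_eqF ?exprn_gt0//.
  by rewrite divff ?gt_eqF// mule1.
by rewrite -muleA -EFinM mulrCA divff ?gt_eqF// mulr1 muleC => <-.
Qed.

End change_of_variables.

(** * The reference simplex and the cone over it *)

Section cone.
Context (R : realType).

Definition std_simplex n : set (euclid R n) :=
  [set y | (forall j, 0 <= tnth y j) /\ \sum_j tnth y j <= 1].

(* The cone over {1} * std_simplex n with apex 0. *)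
Definition std_cone n : set (euclid R n.+1) :=
  [set u | [/\ tnth u ord0 <= 1, forall j, 0 <= tnth u (lift ord0 j) &
              \sum_j tnth u (lift ord0 j) <= tnth u ord0]].

Lemma measurable_std_simplex n : measurable (@std_simplex n).
Proof.
apply: measurableI.
  apply: measurable_forall_fin => j; apply: measurable_set_le => //.
  exact: measurable_tnth.
apply: measurable_set_le => //.
by apply: measurable_sum => j; exact: measurable_tnth.
Qed.

Lemma measurable_std_cone n : measurable (@std_cone n).
Proof.
rewrite (_ : @std_cone n = [set u | tnth u ord0 <= 1] `&`
    [set u | forall j, 0 <= tnth u (lift ord0 j)] `&`
    [set u | \sum_j tnth u (lift ord0 j) <= tnth u ord0]); last first.
  by apply/seteqP; split=> u /= => [[]|[[]]].
apply: measurableI; first apply: measurableI.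
- by apply: measurable_set_le => //; exact: measurable_tnth.
- apply: measurable_forall_fin => j; apply: measurable_set_le => //.
  exact: measurable_tnth.
- apply: measurable_set_le; last exact: measurable_tnth.
  by apply: measurable_sum => j; exact: measurable_tnth.
Qed.

Lemma std_cone_econs n (t : R) (y : euclid R n) :
  std_cone (econs (t, y)) <->
  [/\ t <= 1, forall j, 0 <= tnth y j & \sum_j tnth y j <= t].
Proof.
rewrite /std_cone /= tnth0; under eq_bigr do rewrite tnthS.
by split=> -[t1 y0 yt]; split=> // j; have := y0 j; rewrite tnthS.
Qed.

Lemma std_cone_tscale n (t : R) (y : euclid R n) : 0 < t ->
  std_cone (econs (t, tscale t y)) <-> t <= 1 /\ std_simplex y.
Proof.
move=> t0; rewrite std_cone_econs.
under eq_bigr do rewrite tnth_mktuple.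
have E x : (t * x <= t) = (x <= 1) by rewrite -[leRHS]mulr1 ler_pM2l.
rewrite -mulr_sumr E.
split=> [[t1 y0 yt]|[t1 [y0 yt]]].
  by split=> //; split=> // j; have := y0 j; rewrite tnth_mktuple pmulr_rge0.
by split=> // j; rewrite tnth_mktuple mulr_ge0// ltW.
Qed.

(** Slicing by the first coordinate: the slice at height t is the reference simplex dilated by t,
    whence the weight t^n. *)
Lemma integral_std_cone n (g : euclid R n.+1 -> \bar R) :
  measurable_fun [set: _] g -> (forall x, 0 <= g x)%E ->
  (\int[lebesgueN R n.+1]_(u in @std_cone n) g u =
   \int[lebesgue_measure]_(t in `]0%R, 1%R]) ((t ^+ n)%:E *
     \int[lebesgueN R n]_(y in @std_simplex n) g (econs (t, tscale t y))))%E.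
Proof.
move=> mg g0; pose gT := g \_ (@std_cone n).
have mgT : measurable_fun [set: _] gT.
  apply/(measurable_restrictT _ _).1; first exact: measurable_std_cone.
  exact: measurable_funTS.
have gT0 u : (0 <= gT u)%E by rewrite /gT patchE; case: ifP.
pose h (t : R) : \bar R := (\int[lebesgueN R n]_y gT (econs (t, y)))%E.
have mh : measurable_fun [set: R] h.
  apply: (measurable_fun_fubini_tonelli_F (gT \o @econs R n)) => [|x].
    by apply: measurableT_comp => //; exact: measurable_econs.
  exact: gT0.
have h_out t : t \notin `[0, 1] -> h t = 0%E.
  move=> t01; rewrite /h integral0_eq// => y _; rewrite /gT patchE.
  case: ifPn => //; rewrite inE => /std_cone_econs[t1 y0 yt].
  move: t01; rewrite in_itv/= t1 andbT => /negP; case.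
  by apply: le_trans yt; exact: sumr_ge0.
rewrite integral_mkcond.
transitivity (\int[lebesgue_measure]_t h t)%E; first exact: integral_lebesgueNS.
transitivity (\int[lebesgue_measure]_(t in `[0%R, 1%R]) h t)%E.
  rewrite [RHS]integral_mkcond; apply: eq_integral => t _.
  by rewrite patchE; case: ifPn => //; rewrite mem_setE => /h_out.
(* The null point t = 0 is dropped, since the dilation by t requires t > 0. *)
rewrite -integral_itv_obnd_cbnd; last exact: measurable_funTS.
apply: eq_integral => t; rewrite inE /= in_itv /= => /andP[t0 t1].
rewrite /h (@integral_tscale R n t)//; last first.
  by apply: (measurableT_comp mgT); apply: (measurableT_comp (@measurable_econs R n)).
congr (_ * _)%E; rewrite [RHS]integral_mkcond; apply: eq_integral => y _.
rewrite /gT !patchE; congr (if _ then _ else _).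
have coneE := std_cone_tscale y t0.
apply/idP/idP => /set_mem yS; apply/mem_set; first by have [] := coneE.1 yS.
exact: coneE.2.
Qed.

(** The simplex lies in the cube of radius 1 and contains a small cube in the positive orthant. *)
Lemma std_simplex_measure n : exists2 s : R, 0 < s &
  (lebesgueN R n (@std_simplex n) = s%:E)%E.
Proof.
have mS := @measurable_std_simplex n.
have Sle : (lebesgueN R n (@std_simplex n) <= ((2 * 1) ^+ n)%:E)%E.
  rewrite -lebesgueN_cube//; apply: le_measure; rewrite ?inE//.
    exact: measurable_cube.
  move=> y [y0 y1] i; rewrite ger0_norm//; apply: le_trans y1.
  by rewrite (bigD1 i)//= lerDl sumr_ge0.
(* The cube of radius e translated by (e, ..., e) is [0, 1/(n+1)]^n, on which the coordinates sum to
   at most n/(n+1) <= 1. *)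
pose e : R := (2 * n.+1%:R)^-1.
have e0 : 0 < e by rewrite invr_gt0 mulr_gt0.
pose c : euclid R n := [tuple e | j < n].
have Sge : (((2 * e) ^+ n)%:E <= lebesgueN R n (@std_simplex n))%E.
  rewrite -lebesgueN_cube ?(ltW e0)//.
  have mC := @measurable_cube R n e.
  rewrite -(setIT (cube e)) -(setIT (@std_simplex n)) -!integral_indic//.
  have mI : measurable_fun [set: euclid R n]
    (fun x => (\1_(@std_simplex n) x)%:E : \bar R) by exact/measurable_EFinP.
  rewrite -(integral_tadd c mI) => [|x]; last by rewrite lee_fin.
  apply: ge0_le_integral => //.
  - by apply/measurable_EFinP.
  - by apply: (measurableT_comp mI); exact: measurable_tadd.
  move=> x _; rewrite lee_fin !indicE ler_nat.
  case: (boolP (x \in cube e)) => [/set_mem xe|//]; rewrite mem_set//; split=> [i|].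
    by rewrite !tnth_mktuple; have := xe i; rewrite ler_norml; lra.
  apply: (@le_trans _ _ (\sum_(i < n) 2 * e)).
    apply: ler_sum => i _; rewrite !tnth_mktuple.
    by have := xe i; rewrite ler_norml; lra.
  have -> : 2 * e = n.+1%:R^-1 by rewrite /e invfM mulrA divff// mul1r.
  rewrite sumr_const card_ord -[leLHS]mulr_natl.
  by rewrite ler_pdivrMr// mul1r ler_nat.
exists (fine (lebesgueN R n (@std_simplex n))).
  rewrite -lte_fin fineK; last first.
    by rewrite ge0_fin_numE// (le_lt_trans Sle)// ltry.
  by apply: lt_le_trans Sge; rewrite lte_fin exprn_gt0// mulr_gt0.
by rewrite fineK// ge0_fin_numE// (le_lt_trans Sle)// ltry.
Qed.

End cone.

(** * The simplex as a cone with apex [a i] over the opposite face *)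

Section cone_parametrization.
Context (R : realType) (n : nat) (a : 'I_n.+2 -> euclid R n.+1).
Hypothesis a_indep : affinely_independent a.
Context (i : 'I_n.+2).
Local Notation b := (face_vertices a i).

(** Replacing c_0 by minus the sum of the other weights turns the relation into one among the rows
    of [edges a]. *)
Lemma affine_relation0 (c : 'I_n.+2 -> R) : \sum_m c m = 0 ->
  (forall j, \sum_m c m * tnth (a m) j = 0) -> forall m, c m = 0.
Proof.
move=> c0 ca0; pose v : 'rV[R]_n.+1 := \row_k c (lift ord0 k).
have : v *m edges a == 0.
  apply/eqP/rowP => j; rewrite !mxE.
  under eq_bigr do rewrite !mxE mulrBr.
  rewrite sumrB -mulr_suml; have := ca0 j; have := c0; rewrite !big_ord_recl /=.
  move=> /eqP; rewrite addr_eq0 => /eqP ->.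
  by rewrite mulNr addrC.
rewrite mulmx_free_eq0// => /eqP v0.
have cS k : c (lift ord0 k) = 0.
  by have := congr1 (fun w : 'rV_n.+1 => w 0 k) v0; rewrite !mxE.
move=> m; have [k ->|->] := unliftP ord0 m; first exact: cS.
by have := c0; rewrite big_ord_recl big1// addr0.
Qed.

(* The weights of the point [s *: a i + u *m cone_mx] with respect to the
   vertices a, see [sum_bary_vertices]. *)
Definition bary (s : R) (u : euclid R n.+1) (m : 'I_n.+2) : R :=
  if unlift i m is Some k then
    if unlift ord0 k is Some k' then tnth u (lift ord0 k')
    else tnth u ord0 - \sum_k' tnth u (lift ord0 k')
  else s - tnth u ord0.

(** Row 0 leads from the apex to one vertex of the face and the other rows are edges of the face, so
    that coordinate 0 is a height: 0 at the apex, 1 on the face. *)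
Definition cone_mx : 'M[R]_n.+1 := \matrix_(k, j)
  if unlift ord0 k is Some k' then edges b k' j
  else tnth (b ord0) j - tnth (a i) j.

Lemma sum_bary s u : \sum_m bary s u m = s.
Proof.
rewrite (bigD1_ord i)//= big_ord_recl /= /bary unlift_none liftK unlift_none.
under [X in _ + (_ + X)]eq_bigr do rewrite !liftK.
by rewrite subrK subrK.
Qed.

Lemma sum_bary_vertices s u j : \sum_m bary s u m * tnth (a m) j =
  s * tnth (a i) j + tnth (mxmap cone_mx u) j.
Proof.
rewrite (bigD1_ord i)//= big_ord_recl /= /bary unlift_none liftK unlift_none.
under [X in _ + (_ + X)]eq_bigr do rewrite !liftK.
rewrite tnth_mktuple [in RHS]big_ord_recl mxE unlift_none.
under [in RHS]eq_bigr do rewrite mxE liftK mxE mulrBr.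
rewrite sumrB -mulr_suml /face_vertices /=; ring.
Qed.

(** A kernel vector u gives weights [bary 0 u] of sum 0 that combine the vertices to 0. Affine
    independence makes these weights vanish, and they determine u. *)
Lemma cone_mx_unit : cone_mx \in unitmx.
Proof.
rewrite -row_free_unit; apply/row_freeP/row_freeP.
rewrite -kermx_eq0; apply/eqP/row_matrixP => k; rewrite row0.
have : row k (kermx cone_mx) *m cone_mx = 0.
  by rewrite -row_mul mulmx_ker row0.
move: (row _ _) => v v0.
pose u : euclid R n.+1 := [tuple v ord0 j | j < n.+1].
have bary0 : forall m, bary 0 u m = 0.
  apply: affine_relation0 => [|j]; first exact: sum_bary.
  rewrite sum_bary_vertices mul0r add0r tnth_mktuple.
  have /rowP/(_ j) := v0; rewrite mxE [RHS]mxE => vj; rewrite -[RHS]vj.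
  by apply: eq_bigr => l _; rewrite tnth_mktuple.
apply/rowP => l; rewrite mxE -[LHS](tnth_mktuple (fun j => v ord0 j) l).
have [l' ->|->] := unliftP ord0 l.
  by have := bary0 (lift i (lift ord0 l')); rewrite /bary !liftK.
by have /eqP := bary0 i; rewrite /bary unlift_none sub0r oppr_eq0 => /eqP.
Qed.

Definition cone_param (u : euclid R n.+1) : euclid R n.+1 :=
  tadd (mxmap cone_mx u) (a i).

Lemma cone_paramE u j :
  tnth (cone_param u) j = \sum_m bary 1 u m * tnth (a m) j.
Proof. by rewrite sum_bary_vertices tnth_mktuple mul1r addrC. Qed.

Lemma bary_unique u (c : 'I_n.+2 -> R) : \sum_m c m = 1 ->
  (forall j, tnth (cone_param u) j = \sum_m c m * tnth (a m) j) ->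
  forall m, c m = bary 1 u m.
Proof.
move=> c1 uE m; apply/eqP; rewrite -subr_eq0.
apply/eqP; apply: (affine_relation0 (c := fun m => c m - bary 1 u m)) => [|j].
  by rewrite sumrB c1 sum_bary subrr.
under eq_bigr do rewrite mulrBl.
by rewrite sumrB -uE cone_paramE subrr.
Qed.

Lemma std_coneP u : std_cone u <-> forall m, 0 <= bary 1 u m.
Proof.
split=> [[u1 u0 us] m|u0].
  rewrite /bary; case: unliftP => [k _|_]; last by rewrite subr_ge0.
  by case: unliftP => [k' _|_]//; rewrite subr_ge0.
split=> [|k|].
- by have := u0 i; rewrite /bary unlift_none subr_ge0.
- by have := u0 (lift i (lift ord0 k)); rewrite /bary !liftK.
- by have := u0 (lift i ord0); rewrite /bary liftK unlift_none subr_ge0.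
Qed.

Lemma simplex_cone_param u : simplex a (cone_param u) <-> std_cone u.
Proof.
rewrite std_coneP; split=> [[c [c0 c1] cE] m|u0].
  by rewrite -(bary_unique c1 cE).
by exists (bary 1 u) => [|j]; [split=> //; exact: sum_bary | exact: cone_paramE].
Qed.

(** The face is where the weight of [a i], which is 1 minus the height, vanishes. Weights on the
    face are extended by 0 to compare them with [bary 1 u]. *)
Lemma face_cone_param u :
  simplex b (cone_param u) <-> std_cone u /\ tnth u ord0 = 1.
Proof.
rewrite std_coneP; split=> [[c [c0 c1] cE]|[u0 u1]].
  pose c' m := if unlift i m is Some k then c k else 0.
  have c'E : forall m, c' m = bary 1 u m.
    apply: bary_unique => [|j].
      rewrite (bigD1_ord i)//= /c' unlift_none add0r.
      by under eq_bigr do rewrite liftK.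
    rewrite cE (bigD1_ord i)//= /c' unlift_none mul0r add0r.
    by apply: eq_bigr => k _; rewrite liftK.
  split=> [m|]; first by rewrite -c'E /c'; case: unlift.
  have /esym/eqP := c'E i; rewrite /c' /bary unlift_none subr_eq0.
  by move=> /eqP.
exists (fun k => bary 1 u (lift i k)) => [|j].
  split=> //; have := sum_bary 1 u; rewrite (bigD1_ord i)//=.
  by rewrite {1}/bary unlift_none u1 subrr add0r.
rewrite cone_paramE (bigD1_ord i)//= {1}/bary unlift_none u1 subrr mul0r.
by rewrite add0r.
Qed.

Lemma measurable_cone_param : measurable_fun [set: _] cone_param.
Proof. by apply: measurable_tadd => //; exact: measurable_mxmap. Qed.

(** Measurability passes to preimages and not to images: the inverse exhibits the simplex and its
    face as preimages. *)
Definition cone_param_inv (x : euclid R n.+1) : euclid R n.+1 :=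
  mxmap (invmx cone_mx) (tadd x (tscale (- 1) (a i))).

Lemma cone_param_invK x : cone_param (cone_param_inv x) = x.
Proof.
rewrite /cone_param mxmap_comp mulVmx ?cone_mx_unit// mxmap1.
by apply: eq_from_tnth => j; rewrite !tnth_mktuple mulN1r subrK.
Qed.

Lemma measurable_cone_param_inv : measurable_fun [set: _] cone_param_inv.
Proof.
apply: measurableT_comp; first exact: measurable_mxmap.
exact: measurable_tadd.
Qed.

Lemma measurable_simplex : measurable (simplex a).
Proof.
rewrite (_ : simplex a = cone_param_inv @^-1` @std_cone R n).
  rewrite -[X in measurable X]setTI; apply: measurable_cone_param_inv => //.
  exact: measurable_std_cone.
by apply/seteqP; split=> x /=; rewrite -simplex_cone_param cone_param_invK.
Qed.

Lemma measurable_face : measurable (simplex b).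
Proof.
rewrite (_ : simplex b = cone_param_inv @^-1`
    (@std_cone R n `&` (fun u => tnth u ord0) @^-1` [set 1])).
  rewrite -[X in measurable X]setTI; apply: measurable_cone_param_inv => //.
  apply: measurableI; first exact: measurable_std_cone.
  by rewrite -[X in measurable X]setTI; exact: measurable_tnth.
apply/seteqP; split=> x /=.
  by rewrite -{1}[x]cone_param_invK => /face_cone_param.
by move=> /face_cone_param; rewrite cone_param_invK.
Qed.

(** For fixed y, t runs affinely along the segment from the apex to a point of the face, so that
    polynomials restrict to polynomials in t. *)
Lemma cone_param_ray t y j : tnth (cone_param (econs (t, tscale t y))) j =
  tnth (a i) j + t * (tnth (flat_param b y) j - tnth (a i) j).
Proof.
rewrite !tnth_mktuple big_ord_recl tnth0 mxE unlift_none.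
under eq_bigr do rewrite tnthS tnth_mktuple mxE liftK -mulrA.
rewrite -mulr_sumr /=; ring.
Qed.

Lemma cone_param1 y : cone_param (econs (1, y)) = flat_param b y.
Proof.
have -> : y = tscale 1 y by apply: eq_from_tnth => j; rewrite tnth_mktuple mul1r.
apply: eq_from_tnth => j; rewrite cone_param_ray mul1r addrC subrK.
by congr (tnth (flat_param _ _) _); apply: eq_from_tnth => k; rewrite tnth_mktuple mul1r.
Qed.

Lemma face_flat_param y : simplex b (flat_param b y) <-> std_simplex y.
Proof.
rewrite -cone_param1 face_cone_param std_cone_econs tnth0.
by split=> [[[_ ? ?] _]|[? ?]]; split.
Qed.

End cone_parametrization.

(** * Polynomials in one variable: point values bounded by integrals *)

Section endpoint_evaluation.
Context (R : realType).
Implicit Types (N i j : nat) (s : seq R) (p q : {poly R}).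

(** Up to the sign (-1)^N, the N-th finite difference of f at 0. *)
Definition altsum N (f : nat -> R) : R :=
  \sum_(j < N.+1) (-1) ^+ j * 'C(N, j)%:R * f j.

Lemma altsum_mulid N (f : nat -> R) :
  altsum N.+1 (fun j => j%:R * f j) = - N.+1%:R * altsum N (fun j => f j.+1).
Proof.
rewrite /altsum big_ord_recl /= mul0r mulr0 add0r mulr_sumr.
apply: eq_bigr => j _; rewrite /bump /= add1n exprS.
have E : 'C(N.+1, j.+1)%:R * j.+1%:R = N.+1%:R * 'C(N, j)%:R :> R.
  by rewrite -!natrM mul_bin_diag mulnC.
rewrite (_ : -1 * (-1) ^+ j * 'C(N.+1, j.+1)%:R * (j.+1%:R * f j.+1) =
  - (-1) ^+ j * ('C(N.+1, j.+1)%:R * j.+1%:R) * f j.+1); last by ring.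
by rewrite E; ring.
Qed.

Lemma altsumD N f g : altsum N (fun j => f j + g j) = altsum N f + altsum N g.
Proof. by rewrite /altsum -big_split; apply: eq_bigr => j _; rewrite mulrDr. Qed.

Lemma altsumZ N c f : altsum N (fun j => c * f j) = c * altsum N f.
Proof. by rewrite /altsum mulr_sumr; apply: eq_bigr => j _; rewrite mulrCA. Qed.

Lemma eq_altsum N f g : f =1 g -> altsum N f = altsum N g.
Proof. by move=> fg; apply: eq_bigr => j _; rewrite fg. Qed.

Lemma altsum1 N : altsum N.+1 (fun=> 1) = 0.
Proof.
have := exprDn (1 : R) (-1) N.+1; rewrite subrr expr0n /= => /esym E.
rewrite -[RHS]E; apply: eq_bigr => j _.
by rewrite expr1n mul1r mulr1 mulr_natr.
Qed.

(** The N-th difference kills degrees below N. A factor j + c splits into c, which leaves a shorter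
    product, and j, which lowers the order of the difference and shifts the other roots; hence the
    induction on a bound for the size, with s arbitrary. *)
Lemma altsum_prod N s : (size s < N)%N ->
  altsum N (fun j => \prod_(c <- s) (j%:R + c)) = 0.
Proof.
have [k] := ubnP (size s); elim: k s N => // k ih [|c s] [//|N] /=.
  by move=> _ _; under eq_altsum do rewrite big_nil; exact: altsum1.
rewrite !ltnS => sk sN.
rewrite (@eq_altsum _ _ (fun j => j%:R * (\prod_(c <- s) (j%:R + c)) +
    c * \prod_(c <- s) (j%:R + c))); last first.
  by move=> j; rewrite big_cons mulrDl.
rewrite altsumD altsumZ (ih s N.+1) ?ltnS ?(ltnW sN)// mulr0 addr0 altsum_mulid.
rewrite (@eq_altsum _ _ (fun j => \prod_(c <- [seq 1 + x | x <- s]) (j%:R + c))).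
  by rewrite ih ?size_map// mulr0.
by move=> j; rewrite big_map; apply: eq_bigr => x _; rewrite -natr1 addrA.
Qed.

(** Writing j + c = (j + i + 1) + (c - i - 1), the first part cancels the denominator and is killed
    by [altsum_prod]. Each factor is thus evaluated at the pole j = - (i + 1). *)
Lemma altsum_prod_div N i s : (size s <= N)%N ->
  altsum N (fun j => \prod_(c <- s) (j%:R + c) / (j + i.+1)%:R) =
  \prod_(c <- s) (c - i.+1%:R) * altsum N (fun j => (j + i.+1)%:R^-1).
Proof.
elim: s => [|c s ih] /= sN.
  by rewrite big_nil mul1r; apply: eq_altsum => j; rewrite big_nil mul1r.
rewrite big_cons -mulrA -ih; last exact: ltnW.
rewrite -altsumZ -[RHS]add0r -(altsum_prod sN) -altsumD; apply: eq_altsum => j.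
have j0 : (j + i.+1)%:R != 0 :> R by rewrite pnatr_eq0 addnS.
rewrite big_cons; apply: (mulIf j0).
by rewrite [RHS]mulrDl -[(c - _) * _ * _]mulrA !divfK// natrD; ring.
Qed.

(** Both sides are the integral of (1 - t)^N over [0, 1]. *)
Lemma altsum_inv N : altsum N (fun j => j.+1%:R^-1) = N.+1%:R^-1.
Proof.
have N0 : N.+1%:R != 0 :> R by rewrite pnatr_eq0.
apply: (mulfI N0); rewrite divff// -[RHS]subr0 -(altsum1 N).
rewrite [in RHS]/altsum big_ord_recl /= bin0 expr0 !mulr1 opprD addNKr.
rewrite /altsum mulr_sumr -sumrN; apply: eq_bigr => j _.
rewrite /bump /= add1n exprS mulr1 mulN1r mulNr opprK.
have j0 : j.+1%:R != 0 :> R by rewrite pnatr_eq0.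
apply: (mulIf j0); rewrite !mulrA divfK// -[RHS]mulrA -natrM [(_ * j.+1)%N]mulnC.
by rewrite -mul_bin_diag natrM mulrCA mulrA.
Qed.

(** The integral over [0, 1] in algebraic form, so that the relations defining [evalpoly] become
    finite sums. *)
Definition int01 p : R := \sum_(i < size p) p`_i / i.+1%:R.

Lemma int01E m p : (size p <= m)%N -> int01 p = \sum_(i < m) p`_i / i.+1%:R.
Proof.
move=> pm; rewrite /int01 (big_ord_widen _ (fun i => p`_i / i.+1%:R) pm).
rewrite big_mkcond; apply: eq_bigr => i _; case: ltnP => // pi.
by rewrite nth_default ?mul0r.
Qed.

Lemma int01D p q : int01 (p + q) = int01 p + int01 q.
Proof.
pose m := maxn (size p) (size q).
rewrite !(@int01E m) ?leq_maxl ?leq_maxr ?size_polyD// -big_split.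
by apply: eq_bigr => i _; rewrite coefD mulrDl.
Qed.

Lemma int01Z c p : int01 (c *: p) = c * int01 p.
Proof.
rewrite !(@int01E (size p))// ?size_scale_leq// mulr_sumr.
by apply: eq_bigr => i _; rewrite coefZ mulrA.
Qed.

Lemma int01Xn m : int01 'X^m = m.+1%:R^-1.
Proof.
rewrite /int01 size_polyXn big_ord_recr /= coefXn eqxx mul1r big1 ?add0r// => i _.
by rewrite coefXn ltn_eqF// mul0r.
Qed.

Lemma int01_sum (I : finType) (F : I -> {poly R}) :
  int01 (\sum_i F i) = \sum_i int01 (F i).
Proof.
apply: (big_morph int01 int01D).
by rewrite /int01 size_poly0 big_ord0.
Qed.

Lemma int01_deriv p : int01 p^`() = p.[1] - p.[0].
Proof.
rewrite (@int01E (size p)); last first.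
  by rewrite (leq_trans (size_poly _ _))// leq_pred.
rewrite (@horner_coef_wide _ (size p).+1)// big_ord_recl mulr1 horner_coef0.
rewrite addrC addKr; apply: eq_bigr => i _.
by rewrite coef_deriv expr1n mulr1 -[p`_i.+1 *+ _]mulr_natr mulfK// pnatr_eq0.
Qed.

(* X * evalpoly N is proportional to the N-th derivative of X^(N+1) (1 - X)^N,
   so that evalpoly N represents evaluation at 0 on degree at most N. *)
Definition evalpoly N : {poly R} := \poly_(j < N.+1)
  (N.+1%:R / N`!%:R * ((-1) ^+ j * 'C(N, j)%:R *
    \prod_(c <- iota 2 N) (j%:R + c%:R))).

(** After [altsum_prod_div] the product runs over c - (i + 1) for c from 2 to N + 1. For i > 0 it
    contains 0; for i = 0 it is N!, and [altsum_inv] cancels the remaining N + 1. *)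
Lemma int01_evalpolyX N i : (i <= N)%N ->
  int01 ('X^i * evalpoly N) = (i == 0)%:R.
Proof.
move=> iN; rewrite /evalpoly poly_def mulr_sumr int01_sum.
pose s : seq R := [seq c%:R | c <- iota 2 N].
transitivity (N.+1%:R / N`!%:R *
    altsum N (fun j => \prod_(c <- s) (j%:R + c) / (j + i.+1)%:R)).
  rewrite mulr_sumr; apply: eq_bigr => j _.
  by rewrite -scalerAr -exprD int01Z int01Xn big_map addnS addnC !mulrA.
rewrite altsum_prod_div ?size_map ?size_iota// big_map.
case: i iN => [_|i iN]; last first.
  rewrite (bigD1_seq i.+2) ?iota_uniq//= ?subrr ?mul0r ?mulr0//.
  by rewrite mem_iota /= !ltnS.
under [altsum _ _]eq_altsum do rewrite addn1.
rewrite altsum_inv (_ : \prod_(_ <- _) _ = N`!%:R).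
  by rewrite mulrA divfK ?divff ?pnatr_eq0// -lt0n fact_gt0.
rewrite fact_prod natr_prod /index_iota subSS subn0.
rewrite (iotaDl 1 1) big_map; apply: eq_bigr => c _.
by rewrite natrD addrAC subrr add0r.
Qed.

Lemma int01_evalpoly N p : (size p <= N.+1)%N -> int01 (p * evalpoly N) = p.[0].
Proof.
move=> pN; rewrite -[in LHS](coefK p) poly_def mulr_suml int01_sum.
rewrite (eq_bigr (fun i : 'I_(size p) => p`_i * (i == 0 :> nat)%:R)); last first.
  move=> i _; rewrite -scalerAl int01Z int01_evalpolyX// -ltnS.
  exact: leq_trans (ltn_ord i) pN.
rewrite horner_coef0; have : size p = 0%N -> p`_0 = 0.
  by move=> p0; rewrite nth_default ?p0.
case: (size p) => [->//|m _]; first by rewrite big_ord0.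
by rewrite big_ord_recl mulr1 big1 ?addr0// => i _; rewrite mulr0.
Qed.

Lemma evalpoly0 N : (evalpoly N).[0] = N.+1%:R ^+ 2.
Proof.
rewrite horner_coef0 coef_poly /= expr0 bin0 !mul1r.
under eq_bigr do rewrite add0r.
have -> : \prod_(c <- iota 2 N) c%:R = N.+1`!%:R :> R.
  by rewrite fact_prod natr_prod /index_iota subSS subn0 big_cons mul1r.
by rewrite factS natrM mulrCA divfK ?pnatr_eq0 -?lt0n ?fact_gt0.
Qed.

Lemma horner_continuous_within p (A : set R) : {within A, continuous (horner p)}.
Proof. by apply: continuous_subspaceT; exact: continuous_horner. Qed.

Lemma integral_deriv_horner p (x y : R) : x <= y ->
  (\int[lebesgue_measure]_(t in `[x, y]) (p^`().[t])%:E = (p.[y] - p.[x])%:E)%E.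
Proof.
rewrite le_eqVlt => /predU1P[<-|xy].
  by rewrite set_itv1 integral_set1 subrr.
rewrite (continuous_FTC2 (F := horner p))//.
- exact: horner_continuous_within.
- split=> [z _||]; first exact: derivable_horner.
  + by apply: cvg_at_right_filter; exact: continuous_horner.
  + by apply: cvg_at_left_filter; exact: continuous_horner.
- by move=> z _; rewrite derivE.
Qed.

(** The constant coefficient is a division by 0, that is, 0. *)
Definition antideriv p : {poly R} := \poly_(i < (size p).+1) (p`_i.-1 / i%:R).

Lemma antiderivK p : (antideriv p)^`() = p.
Proof.
apply/polyP => i; rewrite coef_deriv coef_poly ltnS /=; case: ltnP => pi.
  by rewrite -[(_ / _) *+ _]mulr_natr divfK// pnatr_eq0.
by rewrite mul0rn nth_default.
Qed.

(** Positivity is not visible on the coefficients: it comes from the Lebesgue integral through the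
    fundamental theorem of calculus. *)
Lemma int01_ge0 p : (forall t, 0 <= t <= 1 -> 0 <= p.[t]) -> 0 <= int01 p.
Proof.
move=> p0; rewrite -(antiderivK p) int01_deriv -lee_fin.
rewrite -integral_deriv_horner// antiderivK; apply: integral_ge0 => t /=.
by rewrite in_itv /= lee_fin => /p0.
Qed.

(* Cauchy-Schwarz against evalpoly N, whose square has integral (N + 1)^2. *)
Lemma endpoint_square_le N p : (size p <= N.+1)%N ->
  p.[0] ^+ 2 <= N.+1%:R ^+ 2 * int01 (p ^+ 2).
Proof.
move=> pN; set c : R := N.+1%:R ^+ 2.
have c0 : 0 < c by rewrite exprn_gt0.
have sK : (size (evalpoly N) <= N.+1)%N by exact: size_poly.
(* The remainder of the orthogonal projection of p onto [evalpoly N]; its squared norm is that of p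
   minus p(0)^2 / c. *)
pose q := p - (p.[0] / c) *: evalpoly N.
have : 0 <= int01 (q ^+ 2).
  by apply: int01_ge0 => t _; rewrite horner_exp sqr_ge0.
have -> : q ^+ 2 = p ^+ 2 + (- (p.[0] / c) - p.[0] / c) *: (p * evalpoly N) +
    (p.[0] / c) ^+ 2 *: (evalpoly N * evalpoly N).
  rewrite /q; move: (p.[0] / c) (evalpoly N) => d K.
  by rewrite -!mul_polyC polyCB polyCN polyC_exp; ring.
rewrite 2!int01D 2!int01Z !int01_evalpoly// evalpoly0 -/c.
rewrite (_ : _ + _ = int01 (p ^+ 2) - p.[0] ^+ 2 / c); last first.
  by field; rewrite gt_eqF.
by rewrite subr_ge0 ler_pdivrMr// mulrC.
Qed.

(** Substitution in the integral from x to x + d. The sign of d is free: a negative d starts from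
    the right endpoint. *)
Lemma antideriv_shift p (x d : R) :
  (antideriv p).[x + d] - (antideriv p).[x] =
  d * int01 (p \Po (x%:P + d *: 'X)).
Proof.
set l := x%:P + d *: 'X.
have lE t : l.[t] = x + d * t by rewrite !hornerE.
transitivity (int01 ((antideriv p \Po l)^`())).
  by rewrite int01_deriv !horner_comp !lE mulr1 mulr0 addr0.
rewrite deriv_comp antiderivK /l derivD derivC derivZ derivX add0r -int01Z.
by rewrite alg_polyC mulrC mul_polyC.
Qed.

Lemma size_affine_poly_leq (x h : R) :
  ((size (x%:P + h *: 'X)%R).-1 <= 1)%N.
Proof.
rewrite -subn1 leq_subLR; apply: leq_trans (size_polyD _ _) _.
rewrite geq_max (leq_trans (size_polyC_leq1 _))//.
by rewrite (leq_trans (size_scale_leq _ _))// size_polyX.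
Qed.

Lemma endpoint_square_le_itv N p (x d : R) : (size p <= N.+1)%N -> 0 <= d ->
  d * p.[x] ^+ 2 <= N.+1%:R ^+ 2 *
    ((antideriv (p ^+ 2)).[x + d] - (antideriv (p ^+ 2)).[x]) /\
  d * p.[x + d] ^+ 2 <= N.+1%:R ^+ 2 *
    ((antideriv (p ^+ 2)).[x + d] - (antideriv (p ^+ 2)).[x]).
Proof.
move=> pN d0.
have ineq (y e : R) :
    p.[y] ^+ 2 <= N.+1%:R ^+ 2 * int01 (p ^+ 2 \Po (y%:P + e *: 'X)).
  have := @endpoint_square_le N (p \Po (y%:P + e *: 'X)).
  have -> : (p \Po (y%:P + e *: 'X)).[0] = p.[y].
    by rewrite horner_comp; congr p.[_]; rewrite !hornerE ?mulr0 ?addr0.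
  rewrite [in X in _ -> X]expr2 comp_polyM -expr2; apply.
  apply: leq_trans (size_comp_poly_leq _ _) _; rewrite ltnS.
  rewrite (leq_trans (leq_mul (leqnn _) (size_affine_poly_leq _ _)))// muln1 -ltnS.
  by case: (size p) pN.
split; first by rewrite antideriv_shift [leRHS]mulrCA ler_wpM2l.
have := antideriv_shift (p ^+ 2) (x + d) (- d); rewrite addrK mulNr.
by move=> /eqP; rewrite -opprB eqr_opp => /eqP ->; rewrite [leRHS]mulrCA ler_wpM2l.
Qed.

Lemma max_square_le_integral N p (x y z : R) : (size p <= N.+1)%N ->
  x <= z <= y -> (y - x) * p.[z] ^+ 2 <= N.+1%:R ^+ 2 *
    ((antideriv (p ^+ 2)).[y] - (antideriv (p ^+ 2)).[x]).
Proof.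
move=> pN /andP[xz zy].
have zx0 : 0 <= z - x by rewrite subr_ge0.
have yz0 : 0 <= y - z by rewrite subr_ge0.
have [_] := endpoint_square_le_itv x pN zx0.
have [+ _] := endpoint_square_le_itv z pN yz0.
by rewrite !subrKC; lra.
Qed.

(* With M the maximum of p, reached at z: the polynomial p satisfies
   p^2 <= M^(2 - s) p^s, and M^2 is bounded by the integral of p^2 through the
   endpoint inequality on both sides of z. *)
Lemma powR_le_integral N p (s x y : R) : (size p <= N.+1)%N ->
  0 < s <= 1 -> x < y -> (forall t, 0 <= p.[t]) ->
  (((y - x) * p.[y] `^ s)%:E <=
   (N.+1%:R ^+ 2)%:E *
     \int[lebesgue_measure]_(t in `[x, y]) (p.[t] `^ s)%:E)%E.
Proof.
move=> pN /andP[s0 s1] xy p0.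
have [z] := EVT_max (ltW xy) (@horner_continuous_within p `[x, y]).
rewrite in_itv /= => zxy zmax; set M := p.[z] in zmax.
have yM : p.[y] <= M by apply: zmax; rewrite in_itv /= lexx ltW.
have yx0 : 0 < y - x by rewrite subr_gt0.
have int0 : (0 <= \int[lebesgue_measure]_(t in `[x, y]) (p.[t] `^ s)%:E)%E.
  by apply: integral_ge0 => t _; rewrite lee_fin powR_ge0.
(* The negative power M^(s - 2) requires M > 0. If M = 0, then p(y) = 0 and the left-hand side is 0
   because s > 0. *)
have [M0|M0] := eqVneq M 0.
  have -> : p.[y] = 0 by apply/eqP; rewrite eq_le p0 -{1}M0 yM.
  by rewrite powR0 ?gt_eqF// mulr0 mule_ge0// lee_fin sqr_ge0.
have {M0}M0 : 0 < M by rewrite lt_neqAle eq_sym M0 /M p0.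
have Mpow t : x <= t <= y -> M `^ (s - 2) * p.[t] ^+ 2 <= p.[t] `^ s.
  move=> txy; have [t0|t0] := eqVneq p.[t] 0.
    by rewrite t0 expr0n mulr0 powR_ge0.
  have {t0}t0 : 0 < p.[t] by rewrite lt_neqAle eq_sym t0 p0.
  rewrite -powR_mulrn ?(ltW t0)// -[s in leRHS](subrK 2) [leRHS]powRD; last first.
    by rewrite (gt_eqF t0) implybT.
  rewrite ler_pM2r ?powR_gt0// -[s - 2]opprB !powRN lef_pV2 ?posrE ?powR_gt0//.
  apply: ge0_ler_powR; rewrite ?nnegrE ?(ltW t0) ?(ltW M0)//; first by lra.
  by apply: zmax; rewrite in_itv.
have mpow : measurable_fun [set: R] (fun t => p.[t] `^ s).
  apply: (measurableT_comp (measurable_powR s)).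
  by apply: continuous_measurable_fun => t; exact: continuous_horner.
apply: (@le_trans _ _ ((N.+1%:R ^+ 2)%:E *
    \int[lebesgue_measure]_(t in `[x, y])
      ((M `^ (s - 2) *: antideriv (p ^+ 2))^`().[t])%:E)%E); last first.
  apply: lee_wpmul2l; first by rewrite lee_fin sqr_ge0.
  apply: ge0_le_integral => //.
  - move=> t _; rewrite derivZ antiderivK hornerZ horner_exp lee_fin.
    by rewrite mulr_ge0 ?powR_ge0 ?sqr_ge0.
  - apply/measurable_EFinP/measurable_funTS.
    by apply: continuous_measurable_fun => t; exact: continuous_horner.
  - exact/measurable_EFinP/measurable_funTS.
  - move=> t; rewrite derivZ antiderivK hornerZ horner_exp lee_fin /= in_itv /=.
    exact: Mpow.
rewrite integral_deriv_horner ?(ltW xy)// -EFinM lee_fin !hornerZ -mulrBr mulrCA.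
have := max_square_le_integral pN zxy; rewrite -/M.
(* Multiplied by M^(s - 2), the bound on M^2 becomes a bound on M^s, which is at least p(y)^s. *)
rewrite -(ler_pM2l (powR_gt0 (s - 2) M0)); apply: le_trans.
rewrite mulrCA ler_pM2l// -powR_mulrn ?(ltW M0)// -powRD; last first.
  by rewrite (gt_eqF M0) implybT.
by rewrite subrK ge0_ler_powR ?nnegrE ?(ltW s0) ?(ltW M0).
Qed.

End endpoint_evaluation.

Lemma measurable_prod_fun d (T : measurableType d) (R : realType) (I : Type)
    (s : seq I) (F : I -> T -> R) :
  (forall i, measurable_fun [set: T] (F i)) ->
  measurable_fun [set: T] (fun x => \prod_(i <- s) F i x).
Proof.
move=> mF; elim: s => [|i s ih].
  by under eq_fun do rewrite big_nil; exact: measurable_cst.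
by under eq_fun do rewrite big_cons; exact: measurable_funM.
Qed.

(** * Gradients along lines, and the integrand *)

Section polynomials_on_lines.
Context (R : realType) (d : nat).
Implicit Types (w v : mpoly d R).

Lemma msize_mderiv i w : (msize (mderiv i w) <= (msize w).-1)%N.
Proof.
rewrite [leqLHS]msizeE; apply/bigmax_leqP_seq => m mw _.
have : mnm_add m (mnm1 i) \in msupp w.
  rewrite mcoeff_msupp; apply: contraTneq mw => w0.
  by rewrite mcoeff_msupp mcoeff_mderiv w0 mul0rn eqxx.
by move=> /msize_mdeg_lt; rewrite mdegD mdeg1 addn1; case: (msize w).
Qed.

Definition line_poly (x h : 'I_d -> R) w : {poly R} :=
  mmap polyC (fun i => (x i)%:P + h i *: 'X) w.

Lemma horner_line_poly x h w t :
  (line_poly x h w).[t] = meval (fun i => x i + t * h i) w.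
Proof.
rewrite /line_poly /mmap mevalE horner_sum; apply: eq_bigr => m _.
rewrite hornerM hornerC horner_prod; congr (_ * _); apply: eq_bigr => i _.
by rewrite horner_exp !hornerE mulrC.
Qed.

Lemma size_line_poly x h w : (size (line_poly x h w) <= msize w)%N.
Proof.
rewrite /line_poly /mmap; apply: (leq_trans (size_sum _ _ _)).
apply/bigmax_leqP_seq => m mw _; rewrite mul_polyC.
apply: leq_trans (size_scale_leq _ _) _.
apply: leq_trans (msize_mdeg_lt mw).
rewrite mdegE /mmap1; elim/big_rec2: _ => [|i p e _ ih]; first by rewrite size_poly1.
apply: leq_trans (size_polyMleq _ _) _.
have ms : (size (((x i)%:P + h i *: 'X) ^+ m i) <= (m i).+1)%N.
  apply: leq_trans (size_poly_exp_leq _ _) _.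
  by rewrite ltnS -[leqRHS]mul1n leq_mul ?size_affine_poly_leq.
by rewrite -subn1 leq_subLR add1n -addSn -addnS leq_add.
Qed.

Definition grad_poly x h w : {poly R} := \sum_i (line_poly x h (mderiv i w)) ^+ 2.

Definition line_point (x h : 'I_d -> R) (t : R) : euclid R d :=
  [tuple x j + t * h j | j < d].

Lemma grad_norm_ge0 w x : 0 <= grad_norm w x.
Proof. exact: sqrtr_ge0. Qed.

Lemma horner_grad_poly x h w t :
  (grad_poly x h w).[t] = grad_norm w (line_point x h t) ^+ 2.
Proof.
rewrite sqr_sqrtr; last by apply: sumr_ge0 => i _; rewrite sqr_ge0.
rewrite horner_sum; apply: eq_bigr => i _; rewrite horner_exp horner_line_poly.
by congr (_ ^+ 2); apply: meval_eq => j; rewrite tnth_mktuple.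
Qed.

Lemma size_grad_poly x h w r : (0 < r)%N -> (msize w <= r.+1)%N ->
  (size (grad_poly x h w) <= (2 * (r - 1)).+1)%N.
Proof.
move=> r0 wr; apply: (leq_trans (size_sum _ _ _)); apply/bigmax_leqP => i _.
apply: leq_trans (size_poly_exp_leq _ _) _; rewrite ltnS mulnC leq_mul//.
rewrite -!subn1 leq_sub2r// (leq_trans (size_line_poly _ _ _))//.
rewrite (leq_trans (msize_mderiv _ _))//.
by case: (msize w) wr.
Qed.

Lemma measurable_grad_norm w : measurable_fun [set: euclid R d] (grad_norm w).
Proof.
apply: measurableT_comp.
  by apply: continuous_measurable_fun; exact: sqrt_continuous.
apply: measurable_sum => i; apply: measurable_funX.
rewrite (_ : (fun x : euclid R d => _) = (fun x : euclid R d =>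
  \sum_(m <- msupp (mderiv i w)) mcoeff m (mderiv i w) *
    \prod_j tnth x j ^+ m j)); last first.
  by apply/funext => x; rewrite mevalE.
apply: measurable_sum => m; apply: measurable_funM; first exact: measurable_cst.
apply: measurable_prod_fun => j; apply: measurable_funX; exact: measurable_tnth.
Qed.

(** The integrand of the theorem, with e = l/k = p/2 - 1. *)
Definition flux (e : R) w v (x : euclid R d) : R :=
  (grad_norm w x + grad_norm v x) `^ (2 * e) * grad_norm v x ^+ 2.

Lemma flux_ge0 e w v x : 0 <= flux e w v x.
Proof. by rewrite mulr_ge0 ?powR_ge0 ?sqr_ge0. Qed.

Lemma measurable_flux e w v : measurable_fun [set: euclid R d] (flux e w v).
Proof.
apply: measurable_funM; last by apply: measurable_funX; exact: measurable_grad_norm.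
apply: (measurableT_comp (measurable_powR _)).
by apply: measurable_funD; exact: measurable_grad_norm.
Qed.

Lemma measurable_line_point x h : measurable_fun [set: R] (line_point x h).
Proof.
apply: (@measurable_tuple_of R _ (measurableTypeR R) d (fun t j => x j + t * h j)) => j.
by apply: measurable_funD => //; exact: measurable_funM.
Qed.

End polynomials_on_lines.

Section powers.
Context (R : realType).
Implicit Types a b : R.

Lemma powR_root a b (k l : nat) : (0 < k)%N -> 0 <= a -> 0 <= b ->
  (a ^+ l * b ^+ k) `^ k%:R^-1 = a `^ (l%:R / k%:R) * b.
Proof.
move=> k0 a0 b0; rewrite powRM ?exprn_ge0// -!powR_mulrn// -!powRrM.
by rewrite divff ?pnatr_eq0 -?lt0n// powRr1.
Qed.

Lemma powR_sqr a (e : R) : 0 <= a -> a `^ (2 * e) = (a ^+ 2) `^ e.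
Proof. by move=> a0; rewrite powRrM powR_mulrn. Qed.

(** The bounds a^2 + b^2 <= (a + b)^2 <= 2 (a^2 + b^2), raised to the power e. *)
Lemma powR_sqrD_le a b (e : R) : 0 <= e -> 0 <= a -> 0 <= b ->
  (a ^+ 2 + b ^+ 2) `^ e <= (a + b) `^ (2 * e) <=
  2 `^ e * (a ^+ 2 + b ^+ 2) `^ e.
Proof.
move=> e0 a0 b0; have ab0 := addr_ge0 a0 b0.
have s0 : 0 <= a ^+ 2 + b ^+ 2 by rewrite addr_ge0 ?sqr_ge0.
rewrite powR_sqr// -powRM//; apply/andP; split; apply: ge0_ler_powR => //;
  rewrite ?nnegrE ?sqr_ge0 ?mulr_ge0//.
  by rewrite sqrrD -addrA lerD2l lerDr mulrn_wge0 ?mulr_ge0.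
by have := sqr_ge0 (a - b); rewrite sqrrB sqrrD; lra.
Qed.

End powers.

(** * The estimate on one ray *)

(** The hypothesis [0 < c ^+ n] admits c = 0 exactly when n = 0, where the weight t^n is
    constant. *)
Lemma flux_ray_le (R : realType) (d n k l r : nat) (w v : mpoly d R)
    (x h : 'I_d -> R) (c : R) :
  (0 < k)%N -> (0 < r)%N -> (msize w <= r.+1)%N -> (msize v <= r.+1)%N ->
  0 <= c < 1 -> 0 < c ^+ n ->
  ((flux (l%:R / k%:R) w v (line_point x h 1))%:E <=
   (2 `^ (l%:R / k%:R) *
    ((2 * (l + k) * (r - 1)).+1%:R ^+ 2 / ((1 - c) * c ^+ n)))%:E *
   \int[lebesgue_measure]_(t in `]0%R, 1%R])
     (t ^+ n * flux (l%:R / k%:R) w v (line_point x h t))%:E)%E.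
Proof.
move=> k0 r0 wr vr /andP[c0 c1] cn; set e := l%:R / k%:R; set f := flux e w v.
set N := (2 * (l + k) * (r - 1))%N; set I := (\int[_]_(_ in _) _)%E.
have e0 : 0 <= e by rewrite divr_ge0.
pose A := grad_poly x h w; pose B := grad_poly x h v.
pose G := (A + B) ^+ l * B ^+ k.
have sA : (size A <= (2 * (r - 1)).+1)%N by exact: size_grad_poly.
have sB : (size B <= (2 * (r - 1)).+1)%N by exact: size_grad_poly.
have sAB : (size (A + B)%R <= (2 * (r - 1)).+1)%N.
  by rewrite (leq_trans (size_polyD _ _))// geq_max sA.
have sG : (size G <= N.+1)%N.
  rewrite /G (leq_trans (size_polyMleq _ _))// -subn1 leq_subLR add1n /N.
  rewrite mulnC mulnA mulnDr -addnS -addSn leq_add//.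
    rewrite (leq_trans (size_poly_exp_leq _ _))// ltnS leq_mul// mulnC.
    by case: (size _) sAB.
  rewrite (leq_trans (size_poly_exp_leq _ _))// ltnS leq_mul// mulnC.
  by case: (size _) sB.
have A0 t : 0 <= A.[t] by rewrite horner_grad_poly sqr_ge0.
have B0 t : 0 <= B.[t] by rewrite horner_grad_poly sqr_ge0.
have GE t : G.[t] `^ k%:R^-1 = (A.[t] + B.[t]) `^ e * B.[t].
  by rewrite /G hornerM !horner_exp hornerD powR_root// addr_ge0.
have G0 t : 0 <= G.[t].
  by rewrite /G hornerM !horner_exp hornerD mulr_ge0// exprn_ge0// addr_ge0.
have fG t : G.[t] `^ k%:R^-1 <= f (line_point x h t) <= 2 `^ e * G.[t] `^ k%:R^-1.
  rewrite GE !horner_grad_poly mulrA /f /flux.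
  have /andP[lo hi] := powR_sqrD_le e0 (grad_norm_ge0 w (line_point x h t))
    (grad_norm_ge0 v (line_point x h t)).
  by rewrite !ler_wpM2r ?sqr_ge0.
have mG : measurable_fun [set: R] (fun t => G.[t] `^ k%:R^-1).
  apply: (measurableT_comp (measurable_powR _)); exact: measurable_poly.
have mf : measurable_fun [set: R] (fun t => t ^+ n * f (line_point x h t)).
  apply: measurable_funM; first exact: measurable_funX.
  by apply: (measurableT_comp (measurable_flux _ _ _)); exact: measurable_line_point.
have kinv : 0 < (k%:R^-1 : R) <= 1.
  by rewrite invr_gt0 ltr0n k0 invf_le1 ?ltr0n// ler1n.
have := powR_le_integral sG kinv c1 G0.
set J := (\int[_]_(_ in _) _)%E => GJ.
(* On [c, 1] the weight t^n is at least c^n and the integrand dominates G^(1/k); enlarging the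
   domain to [0, 1] only adds a nonnegative part. *)
have JI : ((c ^+ n)%:E * J <= I)%E.
  rewrite /J -ge0_integralZl//; first last.
  - by rewrite lee_fin ltW.
  - by move=> t _; rewrite lee_fin powR_ge0.
  - exact/measurable_EFinP/measurable_funTS.
  rewrite /I integral_itv_obnd_cbnd; last exact/measurable_EFinP/measurable_funTS.
  apply: (@le_trans _ _ (\int[lebesgue_measure]_(t in `[c, 1%R])
      (t ^+ n * f (line_point x h t))%:E)%E).
    apply: ge0_le_integral => //.
    - by move=> t _; rewrite mule_ge0// lee_fin ?powR_ge0// ltW.
    - apply/measurable_EFinP/measurable_funM => //; exact: measurable_funTS.
    - exact/measurable_EFinP/measurable_funTS.
    - move=> t /=; rewrite in_itv /= lee_fin => /andP[ct _].
      apply: ler_pM; rewrite ?powR_ge0 ?(ltW cn)//; last by have /andP[] := fG t.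
      by rewrite lerXn2r// nnegrE (le_trans c0).
  apply: ge0_subset_integral => //.
  - exact/measurable_EFinP/measurable_funTS.
  - move=> t /=; rewrite in_itv /= => /andP[t0 _].
    by rewrite lee_fin mulr_ge0 ?exprn_ge0// flux_ge0.
  - by apply: subset_itvr; rewrite bnd_simp.
have D0 : 0 < (1 - c) * c ^+ n by rewrite mulr_gt0 ?subr_gt0.
apply: (@le_trans _ _ (2 `^ e * G.[1] `^ k%:R^-1)%:E).
  by rewrite lee_fin; have /andP[] := fG 1.
rewrite (_ : (2 `^ e * G.[1] `^ k%:R^-1)%:E = (2 `^ e / ((1 - c) * c ^+ n))%:E *
    ((c ^+ n)%:E * ((1 - c) * G.[1] `^ k%:R^-1)%:E))%E; last first.
  rewrite -!EFinM; congr (_%:E); rewrite [c ^+ n * _]mulrCA mulrA.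
  by field; rewrite (gt_eqF cn) subr_eq0 gt_eqF.
rewrite (_ : 2 `^ e * (N.+1%:R ^+ 2 / ((1 - c) * c ^+ n)) =
  2 `^ e / ((1 - c) * c ^+ n) * N.+1%:R ^+ 2); last by rewrite mulrCA mulrC mulrA mulrAC.
rewrite [in leRHS]EFinM -muleA; apply: lee_wpmul2l.
  by rewrite lee_fin divr_ge0 ?powR_ge0 ?ltW.
apply: le_trans (lee_wpmul2l _ JI); last by rewrite lee_fin sqr_ge0.
by rewrite muleCA; apply: lee_wpmul2l => //; rewrite lee_fin ltW.
Qed.

(** * Tonelli's theorem on a product of two sets *)

Section tonelli_on_rectangles.
Local Open Scope ereal_scope.
Context d1 d2 (T1 : measurableType d1) (T2 : measurableType d2) (R : realType).
Variables (m1 : {sigma_finite_measure set T1 -> \bar R}).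
Variables (m2 : {sigma_finite_measure set T2 -> \bar R}).
Variables (D1 : set T1) (D2 : set T2) (mD1 : measurable D1) (mD2 : measurable D2).
Variable f : T1 * T2 -> \bar R.
Hypotheses (mf : measurable_fun setT f) (f0 : forall x, 0 <= f x).

Let g := f \_ (D1 `*` D2).

Let mg : measurable_fun setT g.
Proof.
apply/(measurable_restrictT _ _).1; first exact: measurableX.
exact: measurable_funTS.
Qed.

Let g0 z : 0 <= g z.
Proof. by rewrite /g patchE; case: ifP. Qed.

Let gE x y : g (x, y) = if (x \in D1) && (y \in D2) then f (x, y) else 0.
Proof.
rewrite /g patchE; congr (if _ then _ else _).
apply/idP/andP => [/set_mem[]|[/set_mem ? /set_mem ?]].
  by move=> ? ?; split; apply/mem_set.
exact/mem_set.
Qed.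

Lemma fubini_tonelli_rectangle :
  \int[m1]_(x in D1) \int[m2]_(y in D2) f (x, y) =
  \int[m2]_(y in D2) \int[m1]_(x in D1) f (x, y).
Proof.
transitivity (\int[m1]_x \int[m2]_y g (x, y)).
  rewrite integral_mkcond; apply: eq_integral => x _; rewrite patchE.
  under [RHS]eq_integral do rewrite gE.
  case: ifPn => xD /=; last by rewrite integral0_eq.
  by rewrite integral_mkcond; apply: eq_integral => y _; rewrite patchE.
rewrite fubini_tonelli//; apply/esym.
rewrite integral_mkcond; apply: eq_integral => y _; rewrite patchE.
under [RHS]eq_integral do rewrite gE andbC.
case: ifPn => yD /=; last by rewrite integral0_eq.
by rewrite integral_mkcond; apply: eq_integral => x _; rewrite patchE.
Qed.

End tonelli_on_rectangles.

Lemma measurable_fun_fubini_tonelli_in d1 d2 (T1 : measurableType d1)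
    (T2 : measurableType d2) (R : realType)
    (m1 : {sigma_finite_measure set T1 -> \bar R}) (D : set T1)
    (f : T1 * T2 -> \bar R) : measurable D ->
  measurable_fun setT f -> (forall x, 0 <= f x)%E ->
  measurable_fun setT (fun y => \int[m1]_(x in D) f (x, y))%E.
Proof.
move=> mD mf f0; pose g := f \_ (D `*` setT).
rewrite (_ : (fun y => _) = (fun y => \int[m1]_x g (x, y))%E); last first.
  apply/funext => y; rewrite integral_mkcond; apply: eq_integral => x _.
  rewrite /g !patchE; congr (if _ then _ else _).
  by apply/idP/idP => /set_mem H; apply/mem_set => //; case: H.
apply: (measurable_fun_fubini_tonelli_G g) => [|z].
  apply/(measurable_restrictT _ _).1; first exact: measurableX.
  exact: measurable_funTS.
by rewrite /g patchE; case: ifP.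
Qed.

(** * From rays to the simplex and its face *)

Section integrals_over_simplex_and_face.
Context (R : realType) (n : nat) (a : 'I_n.+2 -> euclid R n.+1).
Hypothesis a_indep : affinely_independent a.
Context (i : 'I_n.+2).
Local Notation b := (face_vertices a i).
Local Notation jac := (Num.sqrt (\det (edges b *m (edges b)^T))).
Implicit Type f : euclid R n.+1 -> \bar R.

(** The apex is translated to 0, [cone_mx] straightens the simplex into the reference cone, and the
    cone is sliced. The constant does not depend on f, so that f = 1 relates it to |K|. *)
Lemma integral_simplex_cone : exists2 c : R, 0 < c & forall f,
  measurable_fun [set: _] f -> (forall x, 0 <= f x)%E ->
  (\int[lebesgueN R n.+1]_(x in simplex a) f x =
   c%:E * \int[lebesgue_measure]_(t in `]0%R, 1%R]) ((t ^+ n)%:E *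
     \int[lebesgueN R n]_(y in @std_simplex R n)
       f (cone_param a i (econs (t, tscale t y)))))%E.
Proof.
have [c c0 cE] := integral_mxmap (cone_mx_unit a_indep i).
exists c => // f mf f0; have mK := measurable_simplex a_indep i.
pose g := f \_ (simplex a).
have mg : measurable_fun [set: _] g.
  by apply/(measurable_restrictT _ _).1 => //; exact: measurable_funTS.
have g0 u : (0 <= g u)%E by rewrite /g patchE; case: ifP.
transitivity (\int[lebesgueN R n.+1]_x g x)%E; first by rewrite integral_mkcond.
transitivity (\int[lebesgueN R n.+1]_x g (tadd x (a i)))%E.
  by apply/esym; exact: integral_tadd.
rewrite (cE (fun x => g (tadd x (a i)))); first last.
- by move=> x; exact: g0.
- by apply: (measurableT_comp mg); exact: measurable_tadd.
congr (_ * _)%E.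
transitivity (\int[lebesgueN R n.+1]_(u in @std_cone R n) f (cone_param a i u))%E.
  rewrite [RHS]integral_mkcond; apply: eq_integral => u _.
  rewrite /g !patchE; congr (if _ then _ else _).
  have uE := simplex_cone_param a_indep i u.
  by apply/idP/idP => /set_mem ?; apply/mem_set; apply/uE.
apply: (integral_std_cone (g := f \o cone_param a i)) => [|x]; last exact: f0.
by apply: measurableT_comp => //; exact: measurable_cone_param.
Qed.

Lemma integral_face f :
  measurable_fun [set: _] f -> (forall x, 0 <= f x)%E ->
  (\int[flat_measure b]_(x in simplex b) f x =
   jac%:E * \int[lebesgueN R n]_(y in @std_simplex R n) f (flat_param b y))%E.
Proof.
move=> mf f0; have mF := measurable_face a_indep i.
have mp := @measurable_flat_param R n n.+1 b.
pose J : {nonneg R} := NngNum (sqrtr_ge0 (\det (edges b *m (edges b)^T))).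
transitivity (\int[pushforward (mscale J (lebesgueN R n)) (flat_param b)]_(x in
    simplex b) f x)%E; first exact: eq_measure_integral.
rewrite ge0_integral_pushforward//; last exact: measurable_funTS.
rewrite (_ : _ @^-1` _ = @std_simplex R n); last first.
  by apply/seteqP; split=> y /(face_flat_param a_indep i).
rewrite ge0_integral_mscale//; first exact: measurable_std_simplex.
  by apply: measurable_funTS; exact: measurableT_comp.
by move=> y _; exact: f0.
Qed.

Lemma integral_monomial01 :
  (\int[lebesgue_measure]_(t in `]0%R, 1%R]) (t ^+ n)%:E = (n.+1%:R^-1 : R)%:E)%E.
Proof.
rewrite integral_itv_obnd_cbnd; last first.
  by apply/measurable_EFinP/measurable_funTS/measurable_funX.
transitivity (\int[lebesgue_measure]_(t in `[0%R, 1%R])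
    ((n.+1%:R^-1 *: 'X^(n.+1) : {poly R})%R^`().[t])%R%:E)%E.
  apply: eq_integral => t _; rewrite derivZ derivXn hornerZ hornerMn hornerXn.
  by rewrite -[t ^+ _ *+ _]mulr_natl mulrA mulVf ?mul1r// pnatr_eq0.
by rewrite integral_deriv_horner// !hornerZ !hornerXn expr1n expr0n mulr0 subr0 mulr1.
Qed.

(** The bound on rays is integrated over y and Tonelli restores the polar form. With s the measure
    of the reference simplex, f = 1 gives |K| = c s / (n + 1) and |F| = jac s, so that |F| / ((n +
    1) |K|) is jac / c, the quotient of the two Jacobians. *)
Lemma integral_face_le (C : R) (f : euclid R n.+1 -> R) :
  0 <= C -> measurable_fun [set: _] f -> (forall x, 0 <= f x) ->
  (forall y, (f (flat_param b y))%:E <= C%:E *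
    \int[lebesgue_measure]_(t in `]0%R, 1%R])
      (t ^+ n * f (cone_param a i (econs (t, tscale t y))))%:E)%E ->
  (\int[flat_measure b]_(x in simplex b) (f x)%:E <=
   (C * (fine (flat_measure b (simplex b)) /
         (n.+1%:R * fine (lebesgueN R n.+1 (simplex a)))))%:E *
   \int[lebesgueN R n.+1]_(x in simplex a) (f x)%:E)%E.
Proof.
move=> C0 mf f0 fC.
have mS := @measurable_std_simplex R n.
have mEf : measurable_fun [set: _] (EFin \o f) by exact/measurable_EFinP.
have Ef0 x : (0 <= (EFin \o f) x)%E by rewrite lee_fin.
have [s s0 sE] := std_simplex_measure R n.
have [c c0 cE] := integral_simplex_cone.
have mK := measurable_simplex a_indep i; have mF := measurable_face a_indep i.
have KE : lebesgueN R n.+1 (simplex a) = (c * s / n.+1%:R)%:E.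
  rewrite -[LHS]mul1e -integral_cst//.
  rewrite cE//.
  under eq_integral do rewrite integral_cst// mul1e [X in (_ * X)%E]sE.
  rewrite ge0_integralZr//; first last.
  - by rewrite lee_fin ltW.
  - by move=> t /=; rewrite in_itv /= => /andP[t0 _]; rewrite lee_fin exprn_ge0// ltW.
  - by apply/measurable_EFinP/measurable_funTS/measurable_funX.
  by rewrite integral_monomial01 -!EFinM mulrA mulrAC.
have FE : flat_measure b (simplex b) = (jac * s)%:E.
  rewrite -[LHS]mul1e -integral_cst// integral_face//.
  by rewrite integral_cst// mul1e [X in (_ * X)%E]sE.
rewrite integral_face// KE FE /=.
have -> : C * (jac * s / (n.+1%:R * (c * s / n.+1%:R))) = jac * (C / c).
  by field; rewrite !gt_eqF.
rewrite (cE _ mEf Ef0) EFinM -!muleA; apply: lee_wpmul2l.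
  by rewrite lee_fin sqrtr_ge0.
rewrite [leRHS]muleA -EFinM divfK ?gt_eqF//.
(* The absolute value only matters for t < 0: Tonelli wants g nonnegative. *)
pose g (z : measurableTypeR R * euclid R n) : R :=
  `|z.1| ^+ n * f (cone_param a i (econs (z.1, tscale z.1 z.2))).
have mcone : measurable_fun [set: measurableTypeR R * euclid R n]
    (fun z => cone_param a i (econs (z.1, tscale z.1 z.2))).
  apply: (measurableT_comp (@measurable_cone_param R n a i)).
  apply: (measurableT_comp (@measurable_econs R n)).
  by apply: measurable_fun_pair => //; exact: measurable_tscale.
have mg : measurable_fun [set: _] (EFin \o g).
  apply/measurable_EFinP/measurable_funM; last exact: measurableT_comp.
  apply: measurable_funX.
  by apply: measurableT_comp; [exact: normr_measurable | exact: measurable_fst].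
have g0 z : (0 <= (EFin \o g) z)%E by rewrite lee_fin mulr_ge0// exprn_ge0.
have mI : measurable (`]0%R, 1%R]%classic : set (measurableTypeR R)).
  exact: measurable_itv.
have mgI := measurable_fun_fubini_tonelli_in lebesgue_measure mI mg g0.
apply: (@le_trans _ _ (\int[lebesgueN R n]_(y in @std_simplex R n) (C%:E *
    \int[lebesgue_measure]_(t in `]0%R, 1%R]) (g (t, y))%:E))%E).
  apply: ge0_le_integral => //.
  - by move=> y _; rewrite lee_fin.
  - apply: measurable_funTS; apply: (measurableT_comp mEf).
    exact: measurable_flat_param.
  - by apply: measurable_funTS; apply: measurable_funeM.
  - move=> y _; apply: le_trans (fC y) _.
    apply: lee_wpmul2l; first by rewrite lee_fin.
    rewrite le_eqVlt; apply/predU1P; left; apply: eq_integral => t.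
    rewrite inE /= in_itv /= => /andP[t0 _].
    by rewrite /g /= ger0_norm// ltW.
rewrite ge0_integralZl//; first last.
- by move=> y _; apply: integral_ge0 => t _; exact: g0.
- exact: measurable_funTS.
apply: lee_wpmul2l; first by rewrite lee_fin.
rewrite -(fubini_tonelli_rectangle lebesgue_measure (lebesgueN R n) mI mS mg g0).
rewrite le_eqVlt; apply/predU1P; left; apply: eq_integral => t.
rewrite inE /= in_itv /= => /andP[t0 _].
rewrite /g /= ger0_norm ?ltW//.
under eq_integral do rewrite EFinM.
rewrite ge0_integralZl//; last by rewrite lee_fin exprn_ge0// ltW.
  apply: measurable_funTS; apply: (measurableT_comp mEf).
  apply: (measurableT_comp (@measurable_cone_param R n a i)).
  apply: (measurableT_comp (@measurable_econs R n)).
  by apply: measurable_fun_pair => //; exact: measurable_tscale.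
by move=> y _; rewrite lee_fin.
Qed.

End integrals_over_simplex_and_face.

(** * Choice of c and comparison of the constants *)

Theorem lemma4p4 (R : realType) (n : nat) (hd : n.+1 \in [:: 1; 2; 3]%N)
  (p : rat) (hp : 2 < p) (k l : nat) (hk : (0 < k)%N) (hl : (0 < l)%N)
  (hpkl : p = 2 + 2 * l%:R / k%:R)
  (a : 'I_n.+2 -> euclid R n.+1) (ha : affinely_independent a) (i : 'I_n.+2)
  (r : nat) (hr : (0 < r)%N) (w v : mpoly n.+1 R)
  (hw : (msize w <= r.+1)%N) (hv : (msize v <= r.+1)%N) :
  let d := n.+1 in
  let q : R := ratr p in
  let K := simplex a in
  let F := simplex (face_vertices a i) in
  let dx := lebesgueN R d in
  let ds := flat_measure (face_vertices a i) in
  let f x :=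
    (grad_norm w x + grad_norm v x) `^ (q - 2) * grad_norm v x ^+ 2 in
  (\int[ds]_(x in F) (f x)%:E <=
   (2 `^ (q / 2 + k%:R^-1) * C_inv R d *
    ((2 * q ^+ 2 * k%:R ^+ 2 * (r%:R - 1) ^+ 2 + 1) * fine (ds F)
     / (d%:R * fine (dx K))))%:E *
   \int[dx]_(x in K) (f x)%:E)%E.
Proof.
cbv zeta; set q : R := ratr p; set e : R := l%:R / k%:R.
pose f (x : euclid R n.+1) : R :=
  (grad_norm w x + grad_norm v x) `^ (q - 2) * grad_norm v x ^+ 2.
rewrite -/f.
have kn0 : k%:R != 0 :> R by rewrite pnatr_eq0 -lt0n.
have qE : q = 2 + 2 * e.
  by rewrite /q hpkl rmorphD rmorphM rmorphM /= fmorphV /= !ratr_nat -mulrA.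
have e0 : 0 <= e by rewrite divr_ge0.
have fE : f = flux e w v.
  by apply/funext => x; rewrite /f /flux qE addrAC subrr add0r.
rewrite fE.
pose c : R := if n is 0 then 0 else 2^-1.
have c01 : 0 <= c < 1.
  by rewrite /c; case: (n) => [|_]; rewrite ?lexx ?ltr01// invr_ge0 ler0n invf_lt1 ?ltr1n.
have cn0 : 0 < c ^+ n by rewrite /c; case: (n) => [|m]; rewrite ?expr0// exprn_gt0.
set N := (2 * (l + k) * (r - 1))%N.
pose C : R := 2 `^ e * (N.+1%:R ^+ 2 / ((1 - c) * c ^+ n)).
have C0 : 0 <= C.
  by rewrite mulr_ge0 ?powR_ge0// divr_ge0 ?sqr_ge0// mulr_ge0 ?(ltW cn0)//; lra.
have ray y : ((flux e w v (flat_param (face_vertices a i) y))%:E <= C%:E *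
    \int[lebesgue_measure]_(t in `]0%R, 1%R])
      (t ^+ n * flux e w v (cone_param a i (econs (t, tscale t y))))%:E)%E.
  pose x0 := tnth (a i).
  pose h j := tnth (flat_param (face_vertices a i) y) j - tnth (a i) j.
  have lineE t : cone_param a i (econs (t, tscale t y)) = line_point x0 h t.
    by apply: eq_from_tnth => j; rewrite cone_param_ray [RHS]tnth_mktuple.
  have -> : flat_param (face_vertices a i) y = line_point x0 h 1.
    by apply: eq_from_tnth => j; rewrite [RHS]tnth_mktuple mul1r subrKC.
  under eq_integral do rewrite lineE.
  exact: flux_ray_le.
apply: le_trans (integral_face_le ha C0 (measurable_flux e w v)
  (flux_ge0 e w v) ray) _.
apply: lee_wpmul2r.
  by apply: integral_ge0 => x _; rewrite lee_fin flux_ge0.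
rewrite lee_fin; set X := fine _; set Y := n.+1%:R * _.
rewrite -[_ * X / Y]mulrA [leRHS]mulrA; apply: ler_wpM2r.
  by rewrite divr_ge0 ?mulr_ge0 ?fine_ge0 ?measure_ge0.
(* Here p k = 2 (l + k), hence N = p k (r - 1). *)
have -> : 2 * q ^+ 2 * k%:R ^+ 2 * (r%:R - 1) ^+ 2 = 2 * N%:R ^+ 2 :> R.
  rewrite qE /N !natrM natrD natrB// /e; field.
  exact: kn0.
have cE : ((1 - c) * c ^+ n)^-1 = C_inv R n.+1.
  rewrite /C_inv /c; move: hd; rewrite !inE !eqSS => /or3P[] /eqP -> /=.
  - by rewrite expr0 subr0 mulr1 invr1.
  - by rewrite expr1; field.
  - by rewrite expr2; field.
have Cinv0 : 0 <= C_inv R n.+1 by rewrite -cE invr_ge0 mulr_ge0 ?(ltW cn0)//; lra.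
(* Since p/2 = 1 + e, the two sides differ by the factor 2^(1/k). *)
have pow_le : 2 * 2 `^ e <= 2 `^ (q / 2 + k%:R^-1) :> R.
  rewrite -[X in X * _](powRr1 (ler0n R 2)) -powRD ?pnatr_eq0 ?implybT//.
  rewrite ler_powR ?ler1n// qE mulrDl divff// mulrAC divff ?pnatr_eq0// mul1r.
  by rewrite lerDl invr_ge0.
rewrite /C cE; apply: (@le_trans _ _ (2 * 2 `^ e * C_inv R n.+1 *
    (2 * N%:R ^+ 2 + 1))); last first.
  by rewrite !ler_wpM2r// addr_ge0 ?mulr_ge0 ?sqr_ge0.
rewrite (_ : 2 * 2 `^ e * C_inv R n.+1 * (2 * N%:R ^+ 2 + 1) =
  2 `^ e * (2 * (2 * N%:R ^+ 2 + 1) * C_inv R n.+1)); last by ring.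
apply: ler_wpM2l; first exact: powR_ge0.
apply: ler_wpM2r => //.
(* What remains is (N + 1)^2 <= 2 (2 N^2 + 1). *)
have : 0 <= (N%:R : R) by [].
by rewrite -natr1; nra.
Qed.
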